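(* Let $D=(V,E)$ be a finite digraph and $r\in V$. Then for every $c\in\mathbb{R}_+^{E}$ there is an $f\in\mathbb{R}_+^E$ with $f\leq c$ such that for every $v\in V-r$ \[ \lambda_c(v)=\lambda_f(v)=\varrho_f(v), \] and moreover, if $c$ is integral then $f$ can be chosen to be integral. Such an $f$ can be found in strongly polynomial time.
   Context: For $x,y\in\mathbb{R}_+^E$, $x\leq y$ means $x(e)\leq y(e)$ for all $e\in E$. For $U\subseteq V$, $\varrho_x(U):=\sum_{e\in \mathsf{in}_D(U)}x(e)$ and $\delta_x(U):=\sum_{e\in\mathsf{out}_D(U)}x(e)$, where $\mathsf{in}_D(U)$, $\mathsf{out}_D(U)$ are the sets of edges entering, resp. leaving, $U$; for a vertex $v$, $\varrho_x(v):=\varrho_x(\{v\})$. For $v\in V-r$, an $x\in\mathbb{R}_+^E$ is an $r\to v$ flow if $\varrho_x(w)=\delta_x(w)$ for all $w\in V\setminus\{r,v\}$ and $\varrho_x(r)=\delta_x(v)=0$; its amount is $\delta_x(r)$. For $c\in\mathbb{R}_+^E$ and $v\in V-r$, the flow-connectivity is $\lambda_c(v):=\max\{\delta_x(r): x \text{ is an } r\to v \text{ flow with } x\leq c\}$. A vector is integral if all its coordinates are integers. *)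

(* Defs.v *)
From mathcomp Require Import all_boot all_order all_algebra.
From mathcomp Require Import all_classical all_reals all_analysis.

Set Implicit Arguments.
Unset Strict Implicit.
Unset Printing Implicit Defensive.

Import Order.TTheory GRing.Theory Num.Theory.
Import numFieldNormedType.Exports.
Local Open Scope ring_scope.

(* Parallel edges and loops are allowed; a loop neither enters nor leaves any
   vertex set. *)
Record digraph (V E : finType) := Digraph { tail : E -> V; head : E -> V }.

Section Flows.
Variables (R : realType) (V E : finType) (D : digraph V E).
Implicit Types (U : {set V}) (r v w : V) (x y c : E -> R).

Definition in_edges U : {set E} :=
  [set e | (head D e \in U) && (tail D e \notin U)].
Definition out_edges U : {set E} :=
  [set e | (tail D e \in U) && (head D e \notin U)].

Definition inflow x U : R := \sum_(e in in_edges U) x e.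
Definition outflow x U : R := \sum_(e in out_edges U) x e.

Definition nonneg x : Prop := forall e, 0 <= x e.
Definition le_vec x y : Prop := forall e, x e <= y e.
Definition integral_vec x : Prop := forall e, x e \is a Num.int.

Definition is_flow r v x : Prop :=
  [/\ nonneg x,
      forall w, w != r -> w != v -> inflow x [set w] = outflow x [set w],
      inflow x [set r] = 0
    & outflow x [set v] = 0].

(* The supremum is a maximum: see [flow_connectivity_max]. *)
Definition flow_connectivity r c v : R :=
  sup (fun a => exists x, [/\ is_flow r v x, le_vec x c
                            & a = outflow x [set r]]).

Definition preserves_connectivity r c f : Prop :=
  [/\ nonneg f, le_vec f c
    & forall v, v != r ->
        flow_connectivity r c v = flow_connectivity r f v /\
        flow_connectivity r f v = inflow f [set v]].

End Flows.

Section FlowMax.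
Local Open Scope classical_set_scope.
Variables (R : realType) (V E : finType) (D : digraph V E).

Let T : topologicalType := prod_topology (fun _ : E => R : topologicalType).

Let sum_continuous (A : {set E}) :
  continuous (fun x : T => \sum_(e in A) (x : E -> R) e : R).
Proof.
have -> : (fun x : T => \sum_(e in A) (x : E -> R) e : R)
    = \sum_(e in A) (fun x : T => (x : E -> R) e).
  by apply/funext => x; rewrite fct_sumE.
apply: (big_ind (fun g : T -> R => continuous g)).
- by move=> x; apply: (@cst_continuous T R 0 x).
- by move=> f g cf cg x; apply: (@continuousD _ _ _ f g x (cf x) (cg x)).
- by move=> e _; exact: (@proj_continuous E (fun=> R : topologicalType) e).
Qed.

Lemma flow_connectivity_max (r v : V) (c : E -> R) : nonneg c ->
  (exists x, [/\ is_flow D r v x, le_vec x c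
               & outflow D x [set r]%SET = flow_connectivity D r c v]) /\
  (forall x, is_flow D r v x -> le_vec x c ->
     outflow D x [set r]%SET <= flow_connectivity D r c v).
Proof.
move=> c0.
pose K : set T := [set x | forall e, `[0, c e]%classic (x e)].
have cK : compact K.
  exact: (@tychonoff E (fun=> R : topologicalType) (fun e => `[0, c e]%classic)
            (fun e => @segment_compact R 0 (c e))).
pose F (A B : {set E}) : set T :=
  [set x | \sum_(e in A) x e - \sum_(e in B) x e = 0 :> R].
have clF A B : closed (F A B).
  have -> : F A B = (fun x : T => \sum_(e in A) x e - \sum_(e in B) x e : R)
                     @^-1` [set 0] by [].
  apply: preimage_closed; last exact: @closed_eq R 0.
  move=> x _.
  exact: (@continuousB _ _ _ _ _ x (@sum_continuous A x) (@sum_continuous B x)).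
pose G : set T := \bigcap_(p in [set p : {set E} * {set E} |
   (exists w, [/\ w != r, w != v
        & p = (in_edges D [set w]%SET, out_edges D [set w]%SET)]) \/
   p = (in_edges D [set r]%SET, finset.set0) \/
   p = (out_edges D [set v]%SET, finset.set0)]) F p.1 p.2.
have clG : closed G by apply: closed_bigI => p _; exact: clF.
have KG x : (K `&` G) x <-> is_flow D r v x /\ le_vec x c.
  split.
    move=> [Kx Gx]; split; last first.
      by move=> e; have := Kx e; rewrite /= in_itv /= => /andP[].
    split.
    - by move=> e; have := Kx e; rewrite /= in_itv /= => /andP[].
    - move=> w wr wv; apply/eqP; rewrite -subr_eq0; apply/eqP.
      by apply: (Gx (_, _)); left; exists w.
    - have := Gx (in_edges D [set r]%SET, finset.set0).
      by rewrite /F /= big_set0 subr0; apply; right; left.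
    - have := Gx (out_edges D [set v]%SET, finset.set0).
      by rewrite /F /= big_set0 subr0; apply; right; right.
  move=> [[x0 xw xr xv] xc]; split.
    by move=> e; rewrite /= in_itv /= x0 xc.
  move=> p /= [[w [wr wv ->]]|[->|->]] /=; rewrite /F /=.
  - by rewrite -/(inflow D x _) xw // subrr.
  - by rewrite big_set0 subr0.
  - by rewrite big_set0 subr0.
have cKG : compact (K `&` G) by apply: compact_closedI.
have KG0 : (K `&` G) !=set0.
  exists (fun=> 0); apply/KG; split; last by [].
  by split=> // [w _ _| |]; rewrite /inflow /outflow !big1.
have [x] := @compact_EVT_max T R
  (fun x : T => outflow D x [set r]%SET) (K `&` G) KG0 cKG
  (continuous_subspaceT (@sum_continuous _)).
rewrite inE => /KG [fx xc] xmax.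
set S : set R := fun a => exists y, [/\ is_flow D r v y, le_vec y c
                            & a = outflow D y [set r]%SET].
have ubS : ubound S (outflow D x [set r]%SET).
  by move=> _ [y [fy yc ->]]; apply: xmax; rewrite inE; apply/KG.
have lamE : outflow D x [set r]%SET = flow_connectivity D r c v.
  apply/eqP; rewrite eq_le; apply/andP; split.
    apply: ub_le_sup; first by exists (outflow D x [set r]%SET).
    by exists x.
  by apply: ge_sup => //; exists (outflow D x [set r]%SET); exists x.
split; first by exists x.
move=> y fy yc; rewrite -lamE; apply: ubS; by exists y.
Qed.

End FlowMax.

(* Real-arithmetic RAM.  Programs are finite texts over two kinds of
   indirectly addressed, unbounded arrays: integer arrays, holding the
   combinatorial data, and number arrays, holding elements of R.  Numbers can
   only be combined by field operations and compared; nothing converts a number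
   into an integer (no rounding). *)
Inductive iexpr :=
  | ILit of nat
  | IGet of nat & iexpr            (* array name, index *)
  | IAdd of iexpr & iexpr
  | ISub of iexpr & iexpr          (* truncated *)
  | IMul of iexpr & iexpr.

Inductive nexpr :=
  | NLit of rat
  | NGet of nat & iexpr            (* array name, index *)
  | NAdd of nexpr & nexpr
  | NSub of nexpr & nexpr
  | NMul of nexpr & nexpr
  | NDiv of nexpr & nexpr.

Inductive test :=
  | ILe of iexpr & iexpr
  | NLe of nexpr & nexpr
  | TNot of test
  | TAnd of test & test.

Inductive prog :=
  | Skip
  | ISet of nat & iexpr & iexpr    (* array name, index, value *)
  | NSet of nat & iexpr & nexpr    (* array name, index, value *)
  | Seq of prog & prog
  | If of test & prog & prog
  | While of test & prog.

Section Machine.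
Variable R : realType.

Record state := State { ints : nat -> nat -> nat; nums : nat -> nat -> R }.

Fixpoint ieval (s : state) (a : iexpr) : nat :=
  match a with
  | ILit n => n
  | IGet x i => ints s x (ieval s i)
  | IAdd a b => (ieval s a + ieval s b)%N
  | ISub a b => (ieval s a - ieval s b)%N
  | IMul a b => (ieval s a * ieval s b)%N
  end.

Fixpoint neval (s : state) (a : nexpr) : R :=
  match a with
  | NLit q => ratr q
  | NGet x i => nums s x (ieval s i)
  | NAdd a b => neval s a + neval s b
  | NSub a b => neval s a - neval s b
  | NMul a b => neval s a * neval s b
  | NDiv a b => neval s a / neval s b
  end.

Fixpoint teval (s : state) (t : test) : bool :=
  match t with
  | ILe a b => (ieval s a <= ieval s b)%N
  | NLe a b => neval s a <= neval s b
  | TNot t => ~~ teval s t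
  | TAnd t u => teval s t && teval s u
  end.

Definition update (T : Type) (m : nat -> nat -> T) (x i : nat) (a : T) :=
  fun y j => if (y == x) && (j == i) then a else m y j.

(* A configuration is the stack of programs still to be run and the memory.
   A step evaluates the expressions of one instruction, that is, performs a
   number of elementary operations bounded by the length of the program text. *)
Definition config := (seq prog * state)%type.

Definition step (k : config) : config :=
  let: (stack, s) := k in
  match stack with
  | [::] => k
  | Skip :: K => (K, s)
  | ISet x i a :: K =>
      (K, State (update (ints s) x (ieval s i) (ieval s a)) (nums s))
  | NSet x i a :: K =>
      (K, State (ints s) (update (nums s) x (ieval s i) (neval s a)))
  | Seq p q :: K => (p :: q :: K, s)
  | If t p q :: K => ((if teval s t then p else q) :: K, s)
  | While t p :: K => (if teval s t then p :: While t p :: K else K, s)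
  end.

Definition run (p : prog) (s : state) (t : nat) : config :=
  iter t step ([:: p], s).

Definition halted (k : config) : bool := nilp k.1.

Definition memory (k : config) : state := k.2.

Variables (V E : finType) (D : digraph V E).

(* Vertices and edges are numbered by [enum_rank].  Integer array 0 holds
   |V|, |E| and the root, arrays 1 and 2 the tails and the heads of the edges;
   number array 0 holds c.  All other cells are 0. *)
Definition input (r : V) (c : E -> R) : state :=
  let num (v : V) := nat_of_ord (enum_rank v) in
  State (fun x => match x with
                  | 0 => nth 0%N [:: #|V|; #|E|; num r]
                  | 1 => nth 0%N [seq num (tail D e) | e <- enum E]
                  | 2 => nth 0%N [seq num (head D e) | e <- enum E]
                  | _ => fun=> 0%N
                  end)
        (fun x => match x with
                  | 0 => nth 0 [seq c e | e <- enum E]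
                  | _ => fun=> 0
                  end).

(* The result is read from number array 1. *)
Definition output (k : config) : E -> R :=
  fun e => nums (memory k) 1 (enum_rank e).

End Machine.

Definition nat_bits (n : nat) : nat := (trunc_log 2 n).+1.
Definition rat_bits (q : rat) : nat :=
  (nat_bits `|numq q| + nat_bits `|denq q|)%N.

(* Up to the choice of C and k, every polynomial bound in N. *)
Definition poly_bound (C k N : nat) : nat := (C * N.+1 ^ k)%N.

(* [p] is a strongly polynomial algorithm which, for every digraph, root r and
   c >= 0, returns an f with [good D r c f]: the number of steps is polynomial
   in |V| + |E|, whatever the numbers in c; the integers used as indices and
   counters have polynomially many bits; and if c is rational then all numbers
   occurring during the run are rationals of size polynomial in the size of the
   input. *)
Definition strongly_polynomial_algorithm (R : realType)
    (good : forall V E : finType, digraph V E -> V -> (E -> R) -> (E -> R) -> Prop)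
    (p : prog) : Prop :=
  exists C k : nat,
  forall (V E : finType) (D : digraph V E) (r : V) (c : E -> R), nonneg c ->
  let comp := run p (input D r c) in
  let N := (#|V| + #|E|)%N in
  [/\ exists t, [/\ (t <= poly_bound C k N)%N, halted (comp t)
                  & good V E D r c (output (E := E) (comp t))],
      forall t x i,
        (nat_bits (ints (memory (comp t)) x i) <= poly_bound C k N)%N
    & forall q : E -> rat, (forall e, c e = ratr (q e)) ->
      forall t x i, exists2 a : rat,
        nums (memory (comp t)) x i = ratr a
      & (rat_bits a <= poly_bound C k (N + \sum_e rat_bits (q e)))%N].

(* Main.v *)
Require Import Defs.
From mathcomp Require Import all_boot all_order all_algebra.
From mathcomp Require Import all_classical all_reals all_analysis.
From mathcomp Require Import zify lra.
Import Order.TTheory GRing.Theory Num.Theory.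
Local Open Scope ring_scope.

Set Implicit Arguments.
Unset Strict Implicit.
Unset Printing Implicit Defensive.

(** By max-flow min-cut, [lambda_c v] is the minimum inflow of a set containing
    [v] but not [r].  Go through the edges once and lower each to the least
    value that keeps all these minima, namely the largest deficit
    [lambda_c w - lambda_f w] with the edge removed, if positive.  Afterwards
    every edge in the support of [f] enters a tight set, i.e. a set of inflow
    [lambda_c w] for some [w] in it; uncrossing these sets with the smallest
    tight set of [v] shows that the inflow of [v] is [lambda_c v].

    The minimum cuts are computed by a push-relabel method in [|V|^2] rounds.
    A round pushes along all admissible arcs, by decreasing height, and then
    raises by one all vertices but the sink of height below [|V|] with excess;
    either there are none or the sum of the heights, which is less than
    [|V|^2], grows.  At the end some level is empty and gives the cut.

    The program only adds, subtracts and compares, so the bounds on the sizes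
    of the numbers follow from the bound on the number of steps, and integral
    data give integral results. *)

(** * Structured programs, their running time and number sizes *)

(** The only loops are counted ones whose bound is read from memory, so that a bound on the running
    time can be computed from the text. *)
Inductive sprog :=
  | SSkip
  | SISet of nat & iexpr & iexpr
  | SNSet of nat & iexpr & nexpr
  | SSeq of sprog & sprog
  | SIf of test & sprog & sprog
  | SFor of nat & nat & sprog.

Definition counter x := IGet x (ILit 0).

(* [SFor x j p]: the counter is cell 0 of array x and the number of iterations
   is cell j of array 0. *)
Fixpoint compile (p : sprog) : prog :=
  match p with
  | SSkip => Skip
  | SISet x i a => ISet x i a
  | SNSet x i a => NSet x i a
  | SSeq p q => Seq (compile p) (compile q)
  | SIf t p q => If t (compile p) (compile q)
  | SFor x j p =>
      Seq (ISet x (ILit 0) (ILit 0))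
          (While (ILe (IAdd (counter x) (ILit 1)) (IGet 0 (ILit j)))
             (Seq (compile p)
                  (ISet x (ILit 0) (IAdd (counter x) (ILit 1)))))
  end.

Fixpoint iwrites (p : sprog) : seq nat :=
  match p with
  | SSkip | SNSet _ _ _ => [::]
  | SISet x _ _ => [:: x]
  | SSeq p q | SIf _ p q => iwrites p ++ iwrites q
  | SFor x _ p => x :: iwrites p
  end.

Fixpoint nwrites (p : sprog) : seq nat :=
  match p with
  | SSkip | SISet _ _ _ => [::]
  | SNSet x _ _ => [:: x]
  | SSeq p q | SIf _ p q => nwrites p ++ nwrites q
  | SFor _ _ p => nwrites p
  end.

(** Array 0 is never written, so with [j < 2] every loop bound is and stays |V| or |E|; a loop body
    leaves its own counter alone. *)
Fixpoint well_formed (p : sprog) : bool :=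
  match p with
  | SSkip | SNSet _ _ _ => true
  | SISet x _ _ => x != 0%N
  | SSeq p q | SIf _ p q => well_formed p && well_formed q
  | SFor x j p =>
      [&& x != 0%N, (j < 2)%N, x \notin iwrites p & well_formed p]
  end.

(** For a loop, the outer 3 counts the unfolding of the sequence, the initialisation of the counter
    and the last, failing test; the inner 3 counts the test, the unfolding of the body and the
    increment. *)
Fixpoint time (p : sprog) (N : nat) : nat :=
  match p with
  | SSkip | SISet _ _ _ | SNSet _ _ _ => 1
  | SSeq p q | SIf _ p q => (1 + (time p N + time q N))%N
  | SFor _ _ p => (3 + N * (3 + time p N))%N
  end.

Section Semantics.
Variable R : realType.
Implicit Types (s : state R) (p q : sprog).

Definition seti x i a s := State (update (ints s) x i a) (nums s).
Definition setn x i (a : R) s := State (ints s) (update (nums s) x i a).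

(** After a loop the counter on the machine holds the bound, hence the outer [seti] in the last
    case. *)
Fixpoint den p s : state R :=
  match p with
  | SSkip => s
  | SISet x i a => seti x (ieval s i) (ieval s a) s
  | SNSet x i a => setn x (ieval s i) (neval s a) s
  | SSeq p q => den q (den p s)
  | SIf t p q => if teval s t then den p s else den q s
  | SFor x j p =>
      seti x 0 (ints s 0 j)
        (iteri (ints s 0 j) (fun i s' => den p (seti x 0 i s')) s)
  end.

Lemma iteri_ind T (P : nat -> T -> Prop) b (f : nat -> T -> T) a :
  P 0%N a -> (forall i a, (i < b)%N -> P i a -> P i.+1 (f i a)) ->
  P b (iteri b f a).
Proof.
move=> P0 PS; elim: b PS => [//|b IH] PS /=.
by apply: (PS) => //; apply: IH => i a' ib; apply: PS; rewrite ltnW.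
Qed.

Lemma den_ints p s x : x \notin iwrites p -> ints (den p s) x = ints s x.
Proof.
elim: p s => [|y i a|y i a|p IHp q IHq|t p IHp q IHq|y j p IHp] s //=.
- by rewrite inE /update => /negPf ->.
- by rewrite mem_cat negb_or => /andP[xp xq]; rewrite IHq // IHp.
- by rewrite mem_cat negb_or => /andP[xp xq]; case: ifP => _; [apply: IHp | apply: IHq].
- rewrite inE negb_or => /andP[/negPf xy xp].
  rewrite /update xy /=.
  apply: (iteri_ind (P := fun _ s' => ints s' x = ints s x)) => // i a _ <-.
  by rewrite IHp // /seti /= /update xy.
Qed.

Lemma den_nums p s x : x \notin nwrites p -> nums (den p s) x = nums s x.
Proof.
elim: p s => [|y i a|y i a|p IHp q IHq|t p IHp q IHq|y j p IHp] s //=.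
- by rewrite inE /update => /negPf ->.
- by rewrite mem_cat negb_or => /andP[xp xq]; rewrite IHq // IHp.
- by rewrite mem_cat negb_or => /andP[xp xq]; case: ifP => _; [apply: IHp | apply: IHq].
- move=> xp.
  apply: (iteri_ind (P := fun _ s' => nums s' x = nums s x)) => // i a _ <-.
  by rewrite IHp.
Qed.

Lemma well_formed_iwrites p : well_formed p -> 0%N \notin iwrites p.
Proof.
elim: p => //= [x _ _|p IHp q IHq|_ p IHp q IHq|x j p IHp].
- by rewrite inE eq_sym.
- by case/andP=> wp wq; rewrite mem_cat negb_or IHp ?IHq.
- by case/andP=> wp wq; rewrite mem_cat negb_or IHp ?IHq.
- by case/and4P=> x0 _ _ wp; rewrite inE negb_or eq_sym x0 IHp.
Qed.

Definition reaches (T : nat) (k k' : config R) :=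
  exists2 t, (t <= T)%N & iter t (@step R) k = k'.

Lemma reaches_step T k k' : reaches T (step k) k' -> reaches T.+1 k k'.
Proof. by case=> t tT <-; exists t.+1 => //; rewrite iterSr. Qed.

Lemma reaches_trans T1 T2 k1 k2 k3 :
  reaches T1 k1 k2 -> reaches T2 k2 k3 -> reaches (T1 + T2) k1 k3.
Proof.
case=> t1 tT1 e1 [t2 tT2 e2]; exists (t2 + t1)%N; last by rewrite iterD e1.
by rewrite addnC leq_add.
Qed.

Lemma reaches_le T1 T2 k k' : (T1 <= T2)%N -> reaches T1 k k' -> reaches T2 k k'.
Proof. by move=> le [t tT e]; exists t => //; apply: leq_trans le. Qed.

Lemma reaches_refl T k : reaches T k k.
Proof. by exists 0%N. Qed.

Lemma compile_correct p N s K : well_formed p ->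
  (forall j, (j < 2)%N -> (ints s 0 j <= N)%N) ->
  reaches (time p N) (compile p :: K, s) (K, den p s).
Proof.
elim: p s K => [|x i a|x i a|p IHp q IHq|t p IHp q IHq|x j p IHp] s K /=.
- by move=> _ _; exists 1%N.
- by move=> _ _; exists 1%N.
- by move=> _ _; exists 1%N.
- case/andP=> wp wq sN; apply: reaches_step => /=.
  apply: reaches_trans (IHp _ _ wp sN) _.
  apply: IHq => // j j2; rewrite den_ints ?sN //.
  exact: well_formed_iwrites.
- case/andP=> wp wq sN; apply: reaches_step => /=.
  case: ifP => _.
    by apply: reaches_le (IHp _ _ wp sN); rewrite leq_addr.
  by apply: reaches_le (IHq _ _ wq sN); rewrite leq_addl.
- case/and4P=> x0 j2 xp wp sN.
  set b := ints s 0 j.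
  set f := fun i s' => den p (seti x 0 i s').
  set loop := While _ _.
  pose body := Seq (compile p)
    (ISet x (ILit 0) (IAdd (counter x) (ILit 1))).
  have f0 i : ints (iteri i f s) 0 = ints s 0.
    elim: i => //= i IH; rewrite /f den_ints ?well_formed_iwrites //=.
    by rewrite /update eq_sym (negPf x0).
  (* Invariant: after [i] iterations the machine is back at the test, with [i] in the counter and
     otherwise the memory of the [i]-fold iterate. *)
  have head i : (i <= b)%N ->
      reaches (i * (3 + time p N)) (loop :: K, seti x 0 0 s)
        (loop :: K, seti x 0 i (iteri i f s)).
    elim: i => [|i IH] ib; first exact: reaches_refl.
    rewrite mulSn addnC.
    apply: reaches_trans (IH (ltnW ib)) _.
    have E : forall s', ints s' 0 j = b -> ints s' x 0 = i ->
      step (loop :: K, s') = (body :: loop :: K, s').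
      by move=> s' e1 e2 /=; rewrite e1 e2 addn1 ib.
    rewrite (_ : 3 + time p N = (time p N + 1).+2)%N; last by lia.
    apply: reaches_step; rewrite E; first last.
    - by rewrite /seti /= /update !eqxx.
    - by rewrite /seti /= /update eq_sym (negPf x0) /= f0.
    apply: reaches_step => /=.
    apply: reaches_trans (IHp _ _ wp _) _.
      move=> j' j'2; rewrite /seti /= /update eq_sym (negPf x0) /= f0.
      exact: sN.
    exists 1%N => //=; rewrite -/(f i (iteri i f s)) /seti.
    rewrite den_ints //= /update !eqxx /= addn1 //.
  rewrite (_ : 3 + _ = (N * (3 + time p N) + 1).+2)%N; last by lia.
  apply: reaches_step => /=; apply: reaches_step => /=.
  rewrite -/loop -/(seti x 0 0 s).
  apply: (@reaches_trans (N * (3 + time p N)) 1 _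
            (loop :: K, seti x 0 b (iteri b f s))).
    by apply: reaches_le (head b (leqnn b)); rewrite leq_mul2r sN ?orbT.
  exists 1%N => //.
  have E : forall s', ints s' 0 j = b -> ints s' x 0 = b ->
    step (loop :: K, s') = (K, s').
    by move=> s' e1 e2 /=; rewrite e1 e2 addn1 ltnn.
  rewrite /= -[LHS]/(step (loop :: K, seti x 0 b (iteri b f s))) E //.
    by rewrite /seti /= /update eq_sym (negPf x0) /= f0.
  by rewrite /seti /= /update !eqxx.
Qed.

End Semantics.

Lemma poly_time (p : sprog) :
  exists C k, forall N, (time p N <= poly_bound C k N)%N.
Proof.
have add f g : (exists C k, forall N, (f N <= poly_bound C k N)%N) ->
    (exists C k, forall N, (g N <= poly_bound C k N)%N) ->
    exists C k, forall N, (f N + g N <= poly_bound C k N)%N.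
  move=> [C [k fP]] [C' [k' gP]]; exists (C + C')%N, (k + k')%N => N.
  rewrite /poly_bound mulnDl leq_add //.
    by apply: leq_trans (fP N) _; rewrite leq_mul2l leq_pexp2l ?leq_addr ?orbT.
  by apply: leq_trans (gP N) _; rewrite leq_mul2l leq_pexp2l ?leq_addl ?orbT.
have cst c : exists C k, forall N : nat, (c <= poly_bound C k N)%N.
  by exists c, 0%N => N; rewrite /poly_bound expn0 muln1.
elim: p => [|x i a|x i a|p IHp q IHq|t p IHp q IHq|x j p IHp] /=.
- exact: cst.
- exact: cst.
- exact: cst.
- by apply: (add (fun=> _)); [exact: cst | exact: add].
- by apply: (add (fun=> _)); [exact: cst | exact: add].
- apply: (add (fun=> _)); first exact: cst.
  have [C [k P]] := add _ _ (cst 3%N) IHp.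
  exists C, k.+1 => N; rewrite /poly_bound expnS mulnCA leq_mul //.
Qed.

(** * Growth of the values under additive programs *)

Fixpoint iweight (a : iexpr) : nat :=
  match a with
  | ILit n => n
  | IGet _ _ => 1
  | IAdd a b => iweight a + iweight b
  | ISub a _ => iweight a
  | IMul _ _ => 0
  end.

(** Indices are unrestricted, as they do not affect the size of the value read; a truncated
    difference never exceeds its left operand. *)
Fixpoint ilinear (a : iexpr) : bool :=
  match a with
  | ILit _ | IGet _ _ => true
  | IAdd a b => ilinear a && ilinear b
  | ISub a _ => ilinear a
  | IMul _ _ => false
  end.

Fixpoint nweight (a : nexpr) : nat :=
  match a with
  | NGet _ _ => 1
  | NAdd a b | NSub a b => nweight a + nweight b
  | _ => 0
  end.

(** Zero is the only literal allowed because it is a multiple of [1/d] for every [d]. *)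
Fixpoint nlinear (a : nexpr) : bool :=
  match a with
  | NLit q => q == 0
  | NGet _ _ => true
  | NAdd a b | NSub a b => nlinear a && nlinear b
  | NMul _ _ | NDiv _ _ => false
  end.

Fixpoint linear_prog (K : nat) (p : prog) : bool :=
  match p with
  | Skip => true
  | ISet _ _ a => ilinear a && (iweight a <= K)%N
  | NSet _ _ a => nlinear a && (nweight a <= K)%N
  | Seq p q | If _ p q => linear_prog K p && linear_prog K q
  | While _ p => linear_prog K p
  end.

Section Size.
Variable R : realType.
Implicit Types (s : state R).

(** For [d > 0] these are the multiples of [1/d] with numerator at most [M]; additions and
    subtractions keep the denominator. The case [d = 1] expresses integrality, and [d = 0] holds for
    every real. *)
Definition grid (d M : nat) (a : R) : Prop :=
  exists2 z : int, a * d%:R = z%:~R & (`|z| <= M)%N.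

Lemma grid0 d M : grid d M 0.
Proof. by exists 0; rewrite ?mul0r. Qed.

Lemma gridD d M M' a b : grid d M a -> grid d M' b -> grid d (M + M') (a + b).
Proof.
move=> [y ya yM] [z zb zM]; exists (y + z); first by rewrite mulrDl ya zb intrD.
by lia.
Qed.

Lemma gridB d M M' a b : grid d M a -> grid d M' b -> grid d (M + M') (a - b).
Proof.
move=> [y ya yM] [z zb zM]; exists (y - z); first by rewrite mulrBl ya zb intrB.
by lia.
Qed.

Lemma grid_le d M M' a : (M <= M')%N -> grid d M a -> grid d M' a.
Proof. by move=> le [z e zM]; exists z => //; apply: leq_trans le. Qed.

Definition bounded d B M s :=
  (forall x i, (ints s x i <= B)%N) /\ (forall x i, grid d M (nums s x i)).

Lemma ieval_bounded d B M s a : (0 < B)%N -> bounded d B M s -> ilinear a ->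
  (ieval s a <= iweight a * B)%N.
Proof.
move=> B0 [sB _]; elim: a => [n|x i _|a IHa b IHb|a IHa b _|//] /=.
- by rewrite leq_pmulr.
- by rewrite mul1n.
- by case/andP=> la lb; rewrite mulnDl leq_add ?IHa ?IHb.
- by move=> la; apply: leq_trans (leq_subr _ _) (IHa la).
Qed.

Lemma neval_bounded d B M s a : bounded d B M s -> nlinear a ->
  grid d (nweight a * M) (neval s a).
Proof.
move=> [_ sM]; elim: a => [q|x i|a IHa b IHb|a IHa b IHb|//|//] /=.
- by move=> /eqP ->; rewrite rmorph0; exact: grid0.
- by rewrite mul1n.
- by case/andP=> la lb; rewrite mulnDl; apply: gridD; auto.
- by case/andP=> la lb; rewrite mulnDl; apply: gridB; auto.
Qed.

Lemma step_bounded K d B M (k : config R) : (0 < K)%N -> (0 < B)%N ->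
  all (linear_prog K) k.1 -> bounded d B M k.2 ->
  all (linear_prog K) (step k).1 /\ bounded d (K * B) (K * M) (step k).2.
Proof.
case: k => stack s /= K0 B0 lin bs.
have bs' : bounded d (K * B) (K * M) s.
  case: bs => sB sM; split=> x i.
    by apply: leq_trans (sB x i) _; rewrite leq_pmull.
  by apply: grid_le (sM x i); rewrite leq_pmull.
case: stack lin => [|[|x i a|x i a|p q|t p q|t p] S] //=.
- case/andP=> /andP[la wa] lS; split=> //; split=> y j; last exact: bs'.2.
  rewrite /= /update; case: ifP => _; last exact: bs'.1.
  by apply: leq_trans (ieval_bounded B0 bs la) _; rewrite leq_mul2r wa orbT.
- case/andP=> /andP[la wa] lS; split=> //; split=> y j; first exact: bs'.1.
  rewrite /= /update; case: ifP => _; last exact: bs'.2.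
  by apply: grid_le (neval_bounded bs la); rewrite leq_mul2r wa orbT.
- by case/andP=> /andP[-> ->] ->.
- by case/andP=> /andP[lp lq] lS; case: ifP; rewrite ?lp ?lq.
- by case/andP=> lp lS; case: ifP; rewrite /= ?lp ?lS.
Qed.

(** The values may grow exponentially in [t], but their numbers of bits grow only linearly. *)
Lemma run_bounded K d B M p s t : (0 < K)%N -> (0 < B)%N ->
  linear_prog K p -> bounded d B M s ->
  bounded d (K ^ t * B) (K ^ t * M) (memory (run p s t)).
Proof.
move=> K0 B0 lp bs.
suff [] : all (linear_prog K) (run p s t).1 /\
    bounded d (K ^ t * B) (K ^ t * M) (memory (run p s t)) by [].
elim: t => [|t [IH1 IH2]]; first by rewrite /= lp !mul1n.
rewrite !expnS -!mulnA; apply: (step_bounded _ _ IH1 IH2) => //.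
by rewrite muln_gt0 expn_gt0 K0.
Qed.

Lemma run_halted p s T t : halted (run p s T) -> (T <= t)%N ->
  run p s t = run p s T.
Proof.
move=> hT /subnK <-; rewrite {1}/run iterD -/(run p s T).
case: (run p s T) hT => [[|//] s'] _.
by elim: (t - T)%N => //= i ->.
Qed.

Lemma nat_bits_le n b : (n < 2 ^ b)%N -> (0 < b)%N -> (nat_bits n <= b)%N.
Proof.
move=> nb b0; rewrite /nat_bits; case: n nb => [|n nb]; first by rewrite trunc_log0.
rewrite -(@ltn_exp2l 2) //; apply: leq_ltn_trans nb.
exact: trunc_logP.
Qed.

Lemma ltn_nat_bits n : (n < 2 ^ nat_bits n)%N.
Proof. by rewrite /nat_bits trunc_log_ltn. Qed.

(** By coprimality in [numq q * d = z * denq q], the reduced numerator divides [z] and the reduced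
    denominator divides [d]. Divisibility gives no bound when [z = 0], but then the numerator is
    0. *)
Lemma grid_rat d M a : (0 < d)%N -> grid d M a ->
  exists2 q : rat, a = ratr q & (`|numq q| <= M)%N /\ (`|denq q| <= d)%N.
Proof.
move=> d0 [z zE zM]; pose q : rat := z%:~R / d%:R; exists q.
  rewrite /q fmorph_div rmorph_int rmorph_nat -zE mulfK //.
  by rewrite pnatr_eq0 -lt0n.
have : q * d%:R = z%:~R by rewrite /q mulfVK // pnatr_eq0 -lt0n.
rewrite -{1}[q]divq_num_den => qE.
have {}qE : numq q * d%:Z = z * denq q.
  apply/eqP; rewrite -(eqr_int rat) !intrM -qE.
  by rewrite mulrAC mulfVK // intr_eq0 denq_neq0.
have {}qE : (`|numq q| * d = `|z| * `|denq q|)%N by rewrite -!abszM -qE abszM.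
have cop := coprime_num_den q.
split.
  have : (`|numq q| %| `|z|)%N.
    by rewrite -(Gauss_dvdl _ cop) -qE dvdn_mulr.
  case: (posnP `|z|%N) => [z0 _|z0 /dvdn_leq -/(_ z0)]; last first.
    by move=> h; apply: leq_trans zM.
  move: qE; rewrite z0 mul0n => /eqP; rewrite muln_eq0 (gtn_eqF d0) orbF.
  by move=> /eqP ->.
apply: dvdn_leq => //.
by rewrite -(@Gauss_dvdr _ `|numq q|) 1?coprime_sym // qE dvdn_mull.
Qed.

Variables (V E : finType) (D : digraph V E).

Lemma input_bounded d M r (c : E -> R) : (forall e, grid d M (c e)) ->
  bounded d (#|V| + #|E|).+1 M (input D r c).
Proof.
have nth_le (s : seq nat) i n :
    (forall j, j \in s -> (j <= n)%N) -> (nth 0%N s i <= n)%N.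
  move=> h; case: (ltnP i (size s)) => [lt|ge]; last by rewrite nth_default.
  exact: h (mem_nth _ lt).
have rk (v : V) : (enum_rank v <= (#|V| + #|E|).+1)%N.
  by apply/ltnW/(leq_trans (ltn_ord _)); rewrite -addnS leq_addr.
move=> cM; split=> x i.
  case: x => [|[|[|x]]] //=; apply: nth_le => j.
  - by rewrite !inE => /or3P[] /eqP ->; rewrite ?rk //; lia.
  - by case/mapP=> e _ ->.
  - by case/mapP=> e _ ->.
case: x => [|x] /=; last exact: grid0.
have [lt|ge] := ltnP i (size [seq c e | e <- enum E]); last first.
  by rewrite nth_default //; exact: grid0.
by have /mapP[e _ ->] := mem_nth 0 lt.
Qed.

End Size.

(** * From structured programs to runs of the machine *)

Section Compile.
Variable R : realType.

Lemma run_compile (V E : finType) (D : digraph V E) (r : V) (c : E -> R)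
    (p : sprog) : well_formed p ->
  exists2 t, (t <= time p (#|V| + #|E|))%N &
    run (compile p) (input D r c) t = ([::], den p (input D r c)).
Proof.
move=> wp.
have [|t tT tE] := @compile_correct R p (#|V| + #|E|) (input D r c) [::] wp.
  by case=> [|[|//]] _ /=; rewrite ?leq_addr ?leq_addl.
by exists t.
Qed.

Lemma den_integral (V E : finType) (D : digraph V E) (r : V) (c : E -> R)
    (p : sprog) K : (0 < K)%N -> well_formed p -> linear_prog K (compile p) ->
  integral_vec c -> forall x i, nums (den p (input D r c)) x i \is a Num.int.
Proof.
move=> K0 wp lp ci x i; have [t _ tE] := run_compile D r c wp.
have [M cM] : exists M, forall e, grid 1 M (c e).
  have cz e : exists z : int, c e = z%:~R by apply/intrP/ci.
  pose z e := projT1 (cid (cz e)).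
  exists (\sum_e `|z e|)%N => e; exists (z e).
    by rewrite mulr1n mulr1; exact: projT2 (cid (cz e)).
  by rewrite (bigD1 e) //= leq_addr.
have [_ /(_ x i)] := run_bounded t K0 (ltn0Sn _) lp (input_bounded D r cM).
by rewrite tE /= => -[z]; rewrite mulr1n mulr1 => -> _; exact: intr_int.
Qed.

(** The product of all denominators is a common denominator of at most [2 ^ S]; over it, each
    numerator is its own numerator times the other denominators. *)
Lemma rat_input_grid (E : finType) (c : E -> R) (q : E -> rat) :
  (forall e, c e = ratr (q e)) -> let S := (\sum_e rat_bits (q e))%N in
  exists d, [/\ (0 < d)%N, (d <= 2 ^ S)%N
              & forall e, grid d (2 ^ (2 * S)) (c e)].
Proof.
move=> cq S; pose d := (\prod_e `|denq (q e)|)%N; exists d.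
have d0 : (0 < d)%N by apply: prodn_gt0 => e; rewrite absz_gt0 denq_neq0.
have dS : (d <= 2 ^ S)%N.
  rewrite /S expn_sum; apply: leq_prod => e _.
  apply: leq_trans (ltnW (ltn_nat_bits _)) _.
  by rewrite leq_exp2l // leq_addl.
split=> // e; exists (numq (q e) * (\prod_(e' | e' != e) `|denq (q e')|)%N%:Z).
  rewrite /d (bigD1 e) //= natrM mulrA rmorphM /= -pmulrn; congr (_ * _).
  have -> : `|denq (q e)|%:R = ratr (denq (q e))%:~R :> R.
    by rewrite rmorph_int -{2}(gez0_abs (denq_ge0 (q e))) pmulrn.
  rewrite cq -rmorphM /= -{1}[q e]divq_num_den mulfVK ?rmorph_int //.
  by rewrite intr_eq0 denq_neq0.
rewrite abszM mul2n -addnn expnD; apply: leq_mul.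
  apply: leq_trans (ltnW (ltn_nat_bits _)) _; rewrite leq_exp2l //.
  by rewrite /S (bigD1 e) //= /rat_bits -addnA leq_addr.
apply: leq_trans dS; rewrite /d [X in (_ <= X)%N](bigD1 e) //= leq_pmull //.
by rewrite absz_gt0 denq_neq0.
Qed.

Lemma linear_strongly_polynomial
    (good : forall V E : finType, digraph V E -> V -> (E -> R) -> (E -> R) -> Prop)
    (p : sprog) : well_formed p -> linear_prog 4 (compile p) ->
  (forall (V E : finType) (D : digraph V E) r (c : E -> R), nonneg c ->
     good V E D r c (fun e => nums (den p (input D r c)) 1 (enum_rank e))) ->
  strongly_polynomial_algorithm good (compile p).
Proof.
move=> wp lp gp; have [C [k Ck]] := poly_time p.
(* With [K = 4] a step adds at most two bits. After [t] steps an integer has at most [2t + N + 1]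
   bits and a rational at most [2t + 3S + 2], where [S] is the size of the numbers in [c]. The extra
   exponent covers the terms linear in [N + S]. *)
exists (2 * C + 3)%N, k.+1 => V E D r c c0 comp N.
have [T TN TE] := run_compile D r c wp.
have {}TN : (T <= C * N.+1 ^ k)%N by apply: leq_trans TN (Ck N).
have hT : halted (comp T) by rewrite /comp TE.
(* The size bounds are required at all times, but the memory no longer changes after halting. *)
have early t : exists2 t', comp t = comp t' & (t' <= C * N.+1 ^ k)%N.
  have [tT|Tt] := leqP t T; first by exists t => //; apply: leq_trans TN.
  by exists T => //; apply: run_halted (ltnW Tt).
have le_pow n m : (n <= m)%N -> (n.+1 ^ k <= m.+1 ^ k.+1)%N.
  move=> nm; apply: (@leq_trans (m.+1 ^ k)).
    by case: (k) => // k'; rewrite leq_exp2r.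
  by rewrite leq_pexp2l.
have le_pow1 n : (n.+1 <= n.+1 ^ k.+1)%N by rewrite expnS leq_pmulr ?expn_gt0.
split.
- exists T; split=> //.
    apply: leq_trans TN _; apply: leq_mul; [lia | exact: le_pow].
  by rewrite /comp /output TE; apply: gp.
- move=> t x i; have [t' -> t'N] := early t.
  (* With [d = 0] the grid condition is void, which leaves the bound on the integers for arbitrary
     real [c]. *)
  have [sB _] : bounded 0 (4 ^ t' * N.+1) (4 ^ t' * 0) (memory (comp t')).
    apply: run_bounded => //; apply: input_bounded => e.
    by exists 0; rewrite ?mulr0.
  apply: leq_trans (_ : 2 * t' + N.+1 <= _)%N.
    apply: nat_bits_le; last by rewrite addnS.
    apply: leq_ltn_trans (sB x i) _; rewrite expnD expnM.
    by rewrite ltn_pmul2l ?expn_gt0 //; apply: ltn_expl.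
  rewrite /poly_bound; have := le_pow _ _ (leqnn N); have := le_pow1 N.
  by move: t'N; move: (N.+1 ^ k)%N (N.+1 ^ k.+1)%N => a b; nia.
- move=> q cq t x i; have [t' -> t'N] := early t.
  have [d [d0 dS cM]] := rat_input_grid cq.
  set S := (\sum_e _)%N in dS cM *.
  have [_ /(_ x i)] := run_bounded t' (isT : (0 < 4)%N) (ltn0Sn _) lp
    (input_bounded D r cM).
  rewrite -/comp => /(grid_rat d0)[a aE [na da]]; exists a => //.
  apply: leq_trans (_ : (2 * t' + 2 * S).+1 + S.+1 <= _)%N.
    apply: leq_add; apply: nat_bits_le => //.
      by apply: leq_ltn_trans na _; rewrite -[4%N]/(2 ^ 2)%N -expnM -expnD ltn_exp2l.
    by apply: leq_ltn_trans da _; apply: leq_ltn_trans dS _; rewrite ltn_exp2l.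
  rewrite /poly_bound.
  have := le_pow _ _ (leq_addr S N); have := le_pow1 (N + S)%N.
  move: t'N; move: (N.+1 ^ k)%N ((N + S).+1 ^ k.+1)%N => u v; nia.
Qed.

End Compile.

(** * Cuts, flows and flames *)

Local Notation head := Defs.head.

Section Cuts.
Variables (R : realType) (V E : finType) (D : digraph V E) (r : V).
Implicit Types (U : {set V}) (u v w : V) (x y c f : E -> R) (L : V -> R).

(** A loop contributes to both sums and cancels; unlike in- and outflow of a set, this quantity can
    be summed over the vertices of the set. *)
Definition net x v : R :=
  \sum_(e | head D e == v) x e - \sum_(e | tail D e == v) x e.

Lemma sum_net x U : \sum_(v in U) net x v = inflow D x U - outflow D x U.
Proof.
have part (g : E -> V) :
    \sum_(v in U) \sum_(e | g e == v) x e = \sum_(e | g e \in U) x e.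
  rewrite (exchange_big_dep (fun e => g e \in U)) /=; last first.
    by move=> v e vU /eqP ->.
  apply: eq_bigr => e eU; rewrite (big_pred1 (g e)) // => v /=.
  by rewrite eq_sym; case: eqP => [->|]; rewrite ?eU ?andbF.
rewrite sumrB !part (bigID (fun e => tail D e \in U)) /=.
rewrite [X in _ - X](bigID (fun e => head D e \in U)) /=.
rewrite (eq_bigl (fun e => (tail D e \in U) && (head D e \in U))); last first.
  by move=> e; rewrite andbC.
rewrite opprD addrACA subrr add0r; congr (_ - _).
  by apply: eq_bigl => e; rewrite inE.
by apply: eq_bigl => e; rewrite inE.
Qed.

Lemma net1 x v : net x v = inflow D x [set v] - outflow D x [set v].
Proof. by rewrite -sum_net big_set1. Qed.

Lemma sum_net_all x : \sum_v net x v = 0.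
Proof.
have -> : \sum_v net x v = \sum_(v in [set: V]) net x v.
  by apply: eq_bigl => v; rewrite inE.
rewrite sum_net /inflow /outflow !big_pred0 ?subrr // => e.
  by rewrite !inE.
by rewrite !inE.
Qed.

Lemma netD x y v : net (fun e => x e + y e) v = net x v + net y v.
Proof. by rewrite /net !big_split /= opprD addrACA. Qed.

Lemma netZ a x v : net (fun e => a * x e) v = a * net x v.
Proof. by rewrite /net -!mulr_sumr mulrBr. Qed.

Lemma net_unit e0 a v :
  net (fun e => if e == e0 then a else 0) v =
  a * ((head D e0 == v)%:R - (tail D e0 == v)%:R).
Proof.
have one (g : E -> V) :
    \sum_(e | g e == v) (if e == e0 then a else 0) = a * (g e0 == v)%:R.
  rewrite -big_mkcondr /=; case: eqP => [e0v|e0v].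
    rewrite (big_pred1 e0) ?mulr1 // => e; rewrite /= andbC.
    by case: eqP => // ->; rewrite e0v eqxx.
  rewrite mulr0 big_pred0 // => e; rewrite andbC.
  by case: eqP => // ->; apply/eqP.
by rewrite /net !one mulrBr.
Qed.

Definition is_cut v U := (v \in U) && (r \notin U).

(** As a relation, it allows values computed by the program to be identified with flow
    connectivities through [min_cut_unique]. *)
Definition min_cut f v (a : R) : Prop :=
  (exists2 U, is_cut v U & inflow D f U = a) /\
  (forall U, is_cut v U -> a <= inflow D f U).

Lemma min_cut_unique f v a b : min_cut f v a -> min_cut f v b -> a = b.
Proof.
move=> [[U cU <-] aP] [[W cW <-] bP].
by apply/eqP; rewrite eq_le aP ?bP.
Qed.

Lemma le_inflow f g U : le_vec f g -> inflow D f U <= inflow D g U.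
Proof. by move=> fg; apply: ler_sum => e _; apply: fg. Qed.

Lemma outflow_ge0 f U : nonneg f -> 0 <= outflow D f U.
Proof. by move=> f0; apply: sumr_ge0 => e _; apply: f0. Qed.

Lemma inflowE f U :
  inflow D f U = \sum_e (if e \in in_edges D U then f e else 0).
Proof. by rewrite /inflow big_mkcond. Qed.

Lemma inflow_submodular f U W : nonneg f ->
  inflow D f (U :&: W) + inflow D f (U :|: W) <= inflow D f U + inflow D f W.
Proof.
move=> f0; rewrite !inflowE -!big_split /=; apply: ler_sum => e _.
have := f0 e; rewrite !inE.
by case: (head D e \in U); case: (head D e \in W); case: (tail D e \in U);
  case: (tail D e \in W) => /=; lra.
Qed.

Section MaxFlowMinCut.
Variables (v : V) (c x : E -> R).
Hypotheses (vr : v != r) (flow : is_flow D r v x) (xc : le_vec x c).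

Let x0 : nonneg x. Proof. by case: flow. Qed.

Let net0 w : w != r -> w != v -> net x w = 0.
Proof. by move=> wr wv; case: flow => _ h _ _; rewrite net1 h ?subrr. Qed.

(** Only [r] and [v] have nonzero net inflow and all net inflows add up to 0, so that of [v] is the
    amount; it is also the sum over [U]. *)
Lemma flow_amount U : is_cut v U ->
  outflow D x [set r] = inflow D x U - outflow D x U.
Proof.
case/andP=> vU rU.
have netr : net x r = - outflow D x [set r].
  by case: flow => _ _ h _; rewrite net1 h sub0r.
have : \sum_u net x u = net x r + net x v.
  rewrite (bigD1 r) //= (bigD1 v) //= big1 ?addr0 // => w /andP[wr wv].
  exact: net0.
rewrite sum_net_all netr => h.
rewrite -sum_net (bigD1 v) //= big1 ?addr0; first by lra.
move=> w /andP[wU wv]; apply: net0 => //.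
by apply: contraNneq rU => <-.
Qed.

Lemma flow_le_cut U : is_cut v U -> outflow D x [set r] <= inflow D c U.
Proof.
move=> cU; rewrite (flow_amount cU).
have := le_inflow U xc; have := outflow_ge0 U x0; lra.
Qed.

(** Edges entering [r] or leaving [v] carry no flow by definition, so augmentation has to avoid
    them. *)
Let usable e := (head D e != r) && (tail D e != v).

Let residual u w := [exists e, usable e &&
  (((tail D e == u) && (head D e == w) && (x e < c e)) ||
   ((head D e == u) && (tail D e == w) && (0 < x e)))].

(** A signed flow of value 1 from [r] to [u] which increases only unsaturated edges and decreases
    only edges carrying flow. *)
Let unit_flow u y :=
  [/\ forall e, 0 < y e -> usable e /\ x e < c e,
      forall e, y e < 0 -> usable e /\ 0 < x e
    & forall w, net y w = (u == w)%:R - (r == w)%:R].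

(* The sum of the unit flows along the arcs of a walk is again a unit flow, so
   the augmenting walk need not be simple. *)
Lemma reachable_unit_flow u : connect residual r u -> exists y, unit_flow u y.
Proof.
case/connectP=> p; elim/last_ind: p u => [|p z IH] u.
  move=> _ ->; exists (fun=> 0); split=> [e|e|w]; rewrite ?ltxx //.
  by rewrite subrr /net !big1 ?subrr.
rewrite rcons_path last_rcons => /andP[pp /existsP[e /andP[us res]]] ->.
have [y [y1 y2 y3]] := IH _ pp erefl.
case/orP: res => /andP[/andP[/eqP te /eqP he] xe].
  exists (fun e' => y e' + (if e' == e then 1 else 0)); split=> [e'|e'|w].
  - by case: eqP => [-> //|_]; rewrite addr0; apply: y1.
  - case: eqP => [-> h|_]; last by rewrite addr0; apply: y2.
    by apply: y2; lra.
  - by rewrite netD y3 net_unit te he mul1r addrC addrA subrK.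
exists (fun e' => y e' + (if e' == e then -1 else 0)); split=> [e'|e'|w].
- case: eqP => [-> h|_]; last by rewrite addr0; apply: y1.
  by apply: y1; lra.
- by case: eqP => [-> //|_]; rewrite addr0; apply: y2.
- by rewrite netD y3 net_unit te he mulN1r opprB addrC addrA subrK.
Qed.

Lemma unit_flow_fits y u : unit_flow u y ->
  exists2 eps, 0 < eps & forall e, 0 <= x e + eps * y e <= c e.
Proof.
move=> [y1 y2 _].
(* Admitting all smaller [t] as well lets the induction over the edges take minima. *)
suff [eps e0 P] : exists2 eps, 0 < eps & forall t, 0 < t -> t <= eps ->
    forall e, e \in enum E -> 0 <= x e + t * y e <= c e.
  by exists eps => // e; apply: P => //; rewrite mem_enum.
elim: (enum E) => [|e s [eps e0 IH]]; first by exists 1.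
have [eps' e'0 P] : exists2 eps, 0 < eps & forall t, 0 < t -> t <= eps ->
    0 <= x e + t * y e <= c e.
  have xe0 := x0 e; have xce := xc e.
  have [ye|ye|ye] := ltgtP (y e) 0.
  - have [_ xe] := y2 e ye; exists (x e / - y e).
      by rewrite divr_gt0 // oppr_gt0.
    move=> t t0; rewrite ler_pdivlMr ?oppr_gt0 // => h.
    have : t * y e <= 0 by rewrite pmulr_rle0 // ltW.
    by move=> h'; apply/andP; split; lra.
  - have [_ xe] := y1 e ye; exists ((c e - x e) / y e).
      by rewrite divr_gt0 // subr_gt0.
    move=> t t0; rewrite ler_pdivlMr // => h.
    have : 0 <= t * y e by rewrite pmulr_rge0 // ltW.
    by move=> h'; apply/andP; split; lra.
  - by exists 1 => // t _ _; rewrite ye mulr0 addr0 xe0 xce.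
exists (Num.min eps eps'); first by rewrite lt_min e0.
move=> t t0; rewrite le_min => /andP[t1 t2] e'.
by rewrite inE => /orP[/eqP ->|]; [apply: P | apply: IH].
Qed.

Hypothesis maximal : forall z, is_flow D r v z -> le_vec z c ->
  outflow D z [set r] <= outflow D x [set r].

(** Otherwise adding a small multiple of a unit flow to [v] would give a flow of larger amount. *)
Lemma sink_unreachable : ~~ connect residual r v.
Proof.
apply/negP => /reachable_unit_flow[y uy].
have [eps e0 P] := unit_flow_fits uy; have [y1 y2 y3] := uy.
pose z e := x e + eps * y e.
have z0 : nonneg z by move=> e; case/andP: (P e).
have netz w : net z w = net x w + eps * net y w by rewrite netD netZ.
have [_ _ inr outv] := flow.
have unus e : ~~ usable e -> y e = 0.
  move=> /negP ue; apply/eqP; case: ltgtP => // [/y2|/y1] [] //.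
have zr : inflow D z [set r] = 0.
  rewrite -inr; apply: eq_bigr => e; rewrite !inE => /andP[/eqP he _].
  by rewrite /z unus ?mulr0 ?addr0 // /usable he eqxx.
have zv : outflow D z [set v] = 0.
  rewrite -outv; apply: eq_bigr => e; rewrite !inE => /andP[/eqP te _].
  by rewrite /z unus ?mulr0 ?addr0 // /usable te eqxx andbF.
have zflow : is_flow D r v z.
  split=> // w wr wv; apply/eqP; rewrite -subr_eq0 -net1 netz net0 // y3.
  by rewrite ![_ == w]eq_sym (negPf wv) (negPf wr) subrr mulr0 addr0.
have := maximal zflow (fun e => (andP (P e)).2).
have := netz r; rewrite y3 (negPf vr) eqxx !net1 zr inr mulr0n mulr1n.
lra.
Qed.

Lemma maximal_flow_cut : min_cut c v (outflow D x [set r]).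
Proof.
split; last by move=> U; apply: flow_le_cut.
pose S := [set u | connect residual r u].
have vS : v \notin S by rewrite inE sink_unreachable.
have rS : r \in S by rewrite inE connect0.
have [_ _ inr outv] := flow.
have cutS : is_cut v (~: S) by rewrite /is_cut !finset.in_setC vS negbK rS.
have stepS h u : u \in S -> residual u h -> h \in S.
  by rewrite !inE => ru uh; apply: connect_trans ru (connect1 uh).
(* The cut is the complement of the set reachable from [r]: edges leaving it carry no flow and edges
   entering it are saturated. *)
exists (~: S) => //; rewrite (flow_amount cutS).
have -> : outflow D x (~: S) = 0.
  apply: big1 => e; rewrite inE !finset.in_setC negbK => /andP[te' he'].
  apply: le_anti; rewrite x0 andbT leNgt; apply/negP => xe.
  have [us|] := boolP (usable e).
    case/negP: te'; apply: (stepS _ _ he'); apply/existsP; exists e.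
    by rewrite us xe !eqxx orbT.
  (* An unusable edge yields no residual arc, but it carries no flow, because [inr] or [outv] is a
     vanishing sum of nonnegative terms; its other end shows that it is not a loop. *)
  rewrite negb_and !negbK => /orP[/eqP hr|/eqP tv].
    suff : x e = 0 by lra.
    move/eqP: inr; rewrite psumr_eq0 => [/allP/(_ e)|? _]; last exact: x0.
    rewrite mem_index_enum !inE hr eqxx /= => /(_ isT) /implyP h.
    by apply/eqP/h; apply: contraNneq te' => ->.
  suff : x e = 0 by lra.
  move/eqP: outv; rewrite psumr_eq0 => [/allP/(_ e)|? _]; last exact: x0.
  rewrite mem_index_enum !inE tv eqxx /= => /(_ isT) /implyP h.
  by apply/eqP/h; apply: contraNneq vS => <-.
rewrite subr0; apply: eq_bigr => e; rewrite inE !finset.in_setC negbK => /andP[he te].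
apply: le_anti; rewrite xc andbT leNgt; apply/negP => xe.
case/negP: (he); apply: (stepS _ _ te); apply/existsP; exists e.
rewrite !eqxx xe /= andbT /usable; apply/andP; split.
  by apply: contraNneq he => ->.
by apply: contraNneq vS => <-.
Qed.

End MaxFlowMinCut.

Lemma flow_connectivity_min_cut c v : nonneg c -> v != r ->
  min_cut c v (flow_connectivity D r c v).
Proof.
move=> c0 vr; have [[x [fx xc xmaxE]] xmax] := flow_connectivity_max D r v c0.
by rewrite -xmaxE; apply: maximal_flow_cut => // z fz zc; rewrite xmaxE; exact: xmax.
Qed.

End Cuts.

(** * Lowering edges and uncrossing tight sets *)

Section Flame.
Variables (R : realType) (V E : finType) (D : digraph V E) (r : V).
Variables (c : E -> R) (L : V -> R).
Implicit Types (U : {set V}) (u v w : V) (f : E -> R).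

Definition tight_edge f e : Prop :=
  exists w U, [/\ w != r, is_cut r w U, e \in in_edges D U & inflow D f U = L w].

(** The state during the pass over the edges: [P] holds for those already lowered, and [L] gives the
    minimum cuts of [c]. *)
Definition reduced (P : E -> Prop) f : Prop :=
  [/\ nonneg f, le_vec f c, forall w, w != r -> min_cut D r f w (L w)
    & forall e, P e -> f e = 0 \/ tight_edge f e].

(** Let [X] be a smallest tight set of [v]. If [v] had larger inflow, some support edge [e] would
    run from [X] to [v], and it enters a tight set [U] of some [w]. Since [X :|: U] is a cut for
    [w], submodularity makes [X :&: U] tight for [v]; it misses the tail of [e], contradicting
    minimality. *)
Lemma reduced_inflow f v : reduced (fun=> True) f -> v != r ->
  inflow D f [set v] = L v.
Proof.
move=> [f0 _ fL tight] vr.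
have [[X1 cX1 X1E] Lmin] := fL v vr.
have cv : is_cut r v [set v] by rewrite /is_cut !inE eqxx eq_sym vr.
pose tX X := is_cut r v X && (inflow D f X == L v).
have tX1 : tX X1 by rewrite /tX cX1 X1E eqxx.
case: (arg_minnP (fun X : {set V} => #|X|) tX1) => X /andP[cX /eqP XE] Xmin.
apply/eqP; rewrite eq_le Lmin // andbT leNgt -XE; apply/negP => lt.
(* An edge into [v] from outside [X] also enters [X], so excess inflow at [v] must come from within
   [X]. *)
have [e /and3P[hv tX' fe]] :
    exists e, [&& e \in in_edges D [set v], tail D e \in X & f e != 0].
  apply/existsP; apply: contraLR lt; rewrite negb_exists => /forallP h.
  rewrite -leNgt !inflowE; apply: ler_sum => e _; have := h e; rewrite !inE.
  have [vX _] := andP cX.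
  case: eqP => [->|_] /=; last by case: ifP; rewrite ?f0.
  case: eqP => _ /=; first by case: ifP; rewrite ?f0.
  by rewrite vX; case: (tail D e \in X) => //=; rewrite negbK => /eqP ->.
case: (tight e Logic.I) => [fe0|[w [U [wr cU eU UE]]]].
  by rewrite fe0 eqxx in fe.
have [/andP[vX rX] /andP[wU rU]] := (cX, cU).
move: eU hv; rewrite !inE => /andP[hU tU] /andP[/eqP hv _].
have cI : is_cut r v (X :&: U) by rewrite /is_cut !inE vX -hv hU (negPf rX).
have cW : is_cut r w (X :|: U) by rewrite /is_cut !inE wU orbT negb_or rX.
have IE : inflow D f (X :&: U) = L v.
  have := inflow_submodular D X U f0; have := Lmin _ cI; have := (fL w wr).2 _ cW.
  rewrite XE UE => h1 h2 h3; apply: le_anti; rewrite h2 andbT; lra.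
have := Xmin (X :&: U); rewrite /tX cI IE eqxx => /(_ isT).
apply/negP; rewrite -ltnNge; apply: proper_card.
apply/properP; split; first exact: subsetIl.
by exists (tail D e) => //; rewrite inE (negPf tU) andbF.
Qed.

Lemma reduced_preserves f : nonneg c ->
  (forall w, w != r -> min_cut D r c w (L w)) ->
  reduced (fun=> True) f -> preserves_connectivity D r c f.
Proof.
move=> c0 cL red; have [f0 fc fL _] := red; split=> // v vr.
have cE := min_cut_unique (flow_connectivity_min_cut D c0 vr) (cL v vr).
have fE := min_cut_unique (flow_connectivity_min_cut D f0 vr) (fL v vr).
by rewrite cE fE (reduced_inflow red vr).
Qed.

Definition set_edge f e a : E -> R := fun e' => if e' == e then a else f e'.

Lemma inflow_set_edge f e a U : inflow D (set_edge f e a) U =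
  inflow D (set_edge f e 0) U + (if e \in in_edges D U then a else 0).
Proof.
rewrite !inflowE (bigD1 e) //= [in RHS](bigD1 e) //= /set_edge eqxx.
rewrite (_ : (if _ then 0 else 0) = 0) ?add0r; last by case: ifP.
rewrite addrC; congr (_ + _); apply: eq_bigr => e' /negPf ->.
by [].
Qed.

Lemma set_edge_id f e : set_edge f e (f e) = f.
Proof. by apply/funext => e'; rewrite /set_edge; case: eqP => [->|]. Qed.

(** Here [b] is the largest deficit or 0. Cuts entered by [e] then have inflow at least [M w + b],
    the others are unchanged, so all cuts stay large enough; if [b] is positive, a minimum cut of a
    maximizing [w] becomes tight. *)
Lemma reduced_step P f e b (M : V -> R) :
  reduced P f ->
  (forall w, w != r -> min_cut D r (set_edge f e 0) w (M w)) ->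
  0 <= b -> (forall w, w != r -> L w - M w <= b) ->
  b = 0 \/ (exists2 w, w != r & b = L w - M w) ->
  reduced (fun e' => P e' \/ e' = e) (set_edge f e b).
Proof.
move=> [f0 fc fL tight] fM b0 bM bE.
have M_in w U : w != r -> is_cut r w U -> M w <= inflow D (set_edge f e 0) U.
  by move=> wr cU; case: (fM w wr) => _; apply.
have L_in w U : w != r -> is_cut r w U -> L w <= inflow D f U.
  by move=> wr cU; case: (fL w wr) => _; apply.
have f_in U : inflow D f U =
    inflow D (set_edge f e 0) U + (if e \in in_edges D U then f e else 0).
  by rewrite -inflow_set_edge set_edge_id.
have bf : b <= f e.
  case: bE => [->|[w wr ->]]; first exact: f0.
  have [[U cU <-] _] := fM w wr; have := L_in w U wr cU.
  rewrite f_in; have := f0 e; case: ifP => _; lra.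
have f'f : le_vec (set_edge f e b) f.
  by move=> e'; rewrite /set_edge; case: eqP => [->|].
have L_in' w U : w != r -> is_cut r w U -> L w <= inflow D (set_edge f e b) U.
  move=> wr cU; rewrite inflow_set_edge.
  have := L_in w U wr cU; have := M_in w U wr cU; have := bM w wr.
  by rewrite f_in; case: ifP => _; lra.
split.
- by move=> e'; rewrite /set_edge; case: eqP.
- by move=> e'; apply: le_trans (f'f e') (fc e').
- move=> w wr; split; last by move=> U; apply: L_in'.
  have [[U cU UE] _] := fL w wr; exists U => //.
  by apply: le_anti; rewrite L_in' // andbT -UE; apply: le_inflow.
move=> e'; have [-> _|e'e] := eqVneq e' e.
  rewrite /set_edge eqxx; case: bE => [->|[w wr bE]]; first by left.
  have [[U cU UE] _] := fM w wr.
  have := L_in w U wr cU; rewrite f_in UE.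
  case: ifP => eU h.
    right; exists w, U; split=> //; rewrite -/(set_edge f e b).
    by rewrite inflow_set_edge UE eU bE addrC subrK.
  (* A minimum cut not entered by [e] was unaffected by its removal, so the deficit is not positive
     and [b = 0]. *)
  by left; apply: le_anti; rewrite b0 bE; lra.
case=> [Pe'|/eqP]; last by rewrite (negPf e'e).
case: (tight e' Pe') => [fe'|[w [U [wr cU eU UE]]]].
  by left; rewrite /set_edge (negPf e'e).
(* A tight set stays tight: lowering an edge cannot raise its inflow, which cannot fall below [L w]
   either. *)
right; exists w, U; split=> //.
by apply: le_anti; rewrite L_in' // andbT -UE; apply: le_inflow.
Qed.

End Flame.

(** * The push-relabel method *)

Section PushRelabel.
Variables (R : realType) (V E : finType) (D : digraph V E) (r w : V).
Variable F : E -> R.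
Hypotheses (wr : w != r) (F0 : nonneg F).
Implicit Types (a : E * bool) (v : V) (X : E -> R) (EX : V -> R) (H : V -> nat).

(* The residual arc [(e, b)] is [e] itself if [b = false], and [e] reversed if
   [b = true]. *)
Definition src a := if a.2 then head D a.1 else tail D a.1.
Definition dst a := if a.2 then tail D a.1 else head D a.1.
Definition res X a := if a.2 then X a.1 else F a.1 - X a.1.

(** Heights are capped at |V|: only the cut is wanted, so excess that cannot reach the sink is not
    returned to [r]. The excess is a separate argument because the program maintains it
    separately. *)
Record preflow X EX H : Prop := Preflow {
  pf_res : forall a, 0 <= res X a;
  pf_net : forall v, EX v = net D X v;
  pf_excess : forall v, v != r -> 0 <= EX v;
  pf_label : forall a, 0 < res X a -> (H (src a) <= (H (dst a)).+1)%N;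
  pf_source : H r = #|V|;
  pf_sink : H w = 0%N;
  pf_height : forall v, (H v <= #|V|)%N }.

Definition stable EX H : Prop :=
  forall v, v != w -> (H v < #|V|)%N -> EX v <= 0.

(** The arc descends by one from level [|V| - 1 - l], written without truncated subtraction. *)
Definition admissible H l a :=
  ((H (src a) + l).+1 == #|V|) && (H (src a) == (H (dst a)).+1).

Definition amount X EX H l a : R :=
  if admissible H l a then
    if EX (src a) <= res X a then EX (src a) else res X a
  else 0.

Definition push_flow X a d : E -> R :=
  fun e => if e == a.1 then (if a.2 then X e - d else X e + d) else X e.

Definition push_excess EX a d : V -> R :=
  fun v => EX v - (if v == src a then d else 0) + (if v == dst a then d else 0).

Lemma push_flow0 X a : push_flow X a 0 = X.
Proof.
by apply/funext => e; rewrite /push_flow subr0 addr0 !if_same.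
Qed.

Lemma push_excess0 EX a : push_excess EX a 0 = EX.
Proof. by apply/funext => v; rewrite /push_excess !if_same subr0 addr0. Qed.

Lemma res_push X a d a' : res (push_flow X a d) a' =
  if a'.1 == a.1 then (if a'.2 == a.2 then res X a' - d else res X a' + d)
  else res X a'.
Proof.
rewrite /res /push_flow; case: a a' => [e b] [e' b'] /=.
by case: eqP => [->|//]; case: b; case: b'; rewrite /= ?opprD ?opprK ?addrA.
Qed.

Lemma net_push X a d v :
  net D (push_flow X a d) v = push_excess (net D X) a d v.
Proof.
have -> : push_flow X a d =
    (fun e => X e + (if e == a.1 then (if a.2 then - d else d) else 0)).
  apply/funext => e; rewrite /push_flow.
  by case: eqP => _; [case: a.2 | rewrite addr0].
rewrite netD net_unit /push_excess /src /dst ![v == _]eq_sym.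
by case: a => e [] /=; case: eqP => _; case: eqP => _;
  rewrite ?mulr1n ?mulr0n; lra.
Qed.

Lemma amount_ge0 X EX H l a : preflow X EX H -> 0 <= amount X EX H l a.
Proof.
case=> res0 _ ex0 _ Hr _ _; rewrite /amount.
case: ifP => // /andP[/eqP e1 /eqP e2]; case: ifP => // _.
by apply: ex0; apply: contra_eqN e1 => /eqP ->; rewrite Hr; apply/eqP; lia.
Qed.

Lemma push_preflow X EX H l a (d := amount X EX H l a) :
  preflow X EX H -> preflow (push_flow X a d) (push_excess EX a d) H.
Proof.
move=> pf; have d0 : 0 <= d := amount_ge0 l a pf.
have [adm|nadm] := boolP (admissible H l a); last first.
  by rewrite /d /amount (negPf nadm) push_flow0 push_excess0.
have [dex dres] : d <= EX (src a) /\ d <= res X a.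
  rewrite /d /amount adm; case: ifP => [//|/negbT].
  by rewrite -ltNge => /ltW.
case/andP: adm => _ /eqP adm; case: pf => res0 exE ex0 lab Hr Hw Hn; split=> //.
- move=> a'; rewrite res_push; case: eqP => // e; have := res0 a'.
  case: eqP => // b; last by lra.
  by rewrite (surjective_pairing a') e b -surjective_pairing; lra.
- by move=> v; rewrite net_push /push_excess exE.
- move=> v vr; rewrite /push_excess; have := ex0 v vr.
  by case: eqP => [->|_]; case: ifP => _; lra.
- move=> a'; rewrite res_push; case: eqP => [e|_]; last exact: lab.
  case: eqP => b h; first by apply: lab; lra.
  (* Only the reverse arc can become residual, and it leads up by one. *)
  move: adm; rewrite /src /dst e; move: b; case: a.2; case: a'.2 => //= _ ->; lia.
Qed.

(** Progress inside a round: the levels above [|V| - 1 - l] are finished, and on that level the arcs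
    in [Q]. A finished descending arc has no excess at its start or is saturated. *)
Definition settled H l (Q : E * bool -> bool) X EX : Prop :=
  forall a, (H (src a) < #|V|)%N -> H (src a) = (H (dst a)).+1 ->
    (#|V| <= H (src a) + l)%N \/ ((H (src a) + l).+1 = #|V| /\ Q a) ->
    EX (src a) = 0 \/ res X a = 0.

(** A push moves excess to a lower level, so no finished arc gains excess at its start; the residual
    capacity it creates is on an ascending arc. *)
Lemma push_settled X EX H l Q a (d := amount X EX H l a) :
  preflow X EX H -> settled H l Q X EX ->
  settled H l (fun a' => Q a' || (a' == a)) (push_flow X a d)
    (push_excess EX a d).
Proof.
move=> pf st; have d0 : 0 <= d := amount_ge0 l a pf.
have [adm|nadm] := boolP (admissible H l a); last first.
  rewrite /d /amount (negPf nadm) push_flow0 push_excess0 => a' h1 h2.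
  case=> [h3|[h3 /orP[h4|/eqP h4]]].
  - by apply: st => //; left.
  - by apply: st => //; right.
  - by move: nadm; rewrite /admissible -h4 h3 h2 !eqxx.
have dE : d = if EX (src a) <= res X a then EX (src a) else res X a.
  by rewrite /d /amount adm.
case/andP: adm => /eqP lev /eqP adm.
move=> a' h1 h2 h3.
have srcdst : src a' != dst a.
  by apply/eqP => h; case: h3 => [|[]]; rewrite h; lia.
have other : a' <> a -> EX (src a') = 0 \/ res X a' = 0.
  move=> ne; apply: st => //; case: h3 => [h3|[h3 /orP[h4|/eqP h4]]].
  - by left.
  - by right.
  - by case: ne.
have ex_a : EX (src a) = 0 -> d = 0.
  by rewrite dE => ->; have := pf_res pf a; case: ifP => // /negP h /h.
rewrite res_push /push_excess (negPf srcdst) addr0.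
have [->|/eqP ne] := eqVneq a' a.
  rewrite !eqxx; rewrite dE; case: ifP => _; [left|right]; exact: subrr.
case: (other ne) => [e0|e0].
  left; rewrite e0; case: eqP => [e|_]; last exact: subr0.
  by rewrite ex_a ?subr0 // -e.
right; case: eqP => [e|_] //.
case: eqP => [e'|ne'].
  by case: ne; rewrite (surjective_pairing a') e e' -surjective_pairing.
case/eqP: srcdst; rewrite /src /dst e.
by move: ne'; case: a.2; case: a'.2.
Qed.

(** Thus a stable state survives all remaining rounds. *)
Lemma push_stable X EX H l a : preflow X EX H -> stable EX H ->
  amount X EX H l a = 0.
Proof.
move=> pf st; rewrite /amount; case: ifP => // /andP[/eqP h1 /eqP h2].
have sw : src a != w by apply: contra_eqN h2 => /eqP ->; rewrite (pf_sink pf).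
have sr : src a != r.
  by apply: contra_eqN h1 => /eqP ->; rewrite (pf_source pf); apply/eqP; lia.
have -> : EX (src a) = 0.
  apply: le_anti; rewrite (pf_excess pf sr) andbT; apply: st => //; lia.
by rewrite (pf_res pf).
Qed.

Definition active EX H v := [&& v != w, (H v < #|V|)%N & ~~ (EX v <= 0)].

Definition relabel EX H v : nat := if active EX H v then (H v).+1 else H v.

(** After the pushes, no residual arc descends from an active vertex, so raising it by one respects
    the labelling, even when several vertices are raised at once. *)
Lemma relabel_preflow X EX H : preflow X EX H ->
  settled H #|V| xpred0 X EX -> preflow X EX (relabel EX H).
Proof.
case=> res0 exE ex0 lab Hr Hw Hn st.
have up v : (H v <= relabel EX H v)%N by rewrite /relabel; case: ifP.
split=> //; last 3 first.
- by rewrite /relabel /active Hr ltnn andbF.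
- by rewrite /relabel /active Hw eqxx.
- by move=> v; rewrite /relabel; case: ifP => // /and3P[].
move=> a ra; have := lab a ra; have := up (dst a).
rewrite {2}/relabel; case: ifP => [/and3P[_ h1 h2]|_]; last by lia.
move=> le1 le2; rewrite ltnS (leq_trans _ le1) // -ltnS ltn_neqAle le2 andbT.
apply/eqP => h3; case: (st a h1 h3) => [|h4|h4]; first by left; lia.
  by rewrite h4 lexx in h2.
by rewrite h4 ltxx in ra.
Qed.

Definition progress k EX H : Prop := stable EX H \/ (k <= \sum_v H v)%N.

Lemma relabel_progress k EX H : progress k EX H ->
  progress k.+1 EX (relabel EX H).
Proof.
have [/existsP[v av]|] := boolP [exists v, active EX H v]; last first.
  rewrite negb_exists => /forallP na _; left => v vw.
  have := na v; rewrite /relabel => /negPf nav; rewrite nav => Hv.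
  by apply: negbFE; move: nav; rewrite /active vw Hv.
case=> [st|le]; last right.
  by case/and3P: av => h1 h2 /negP []; apply: st.
apply: leq_ltn_trans le _; rewrite (bigD1 v) // [X in (_ < X)%N](bigD1 v) //=.
rewrite {1}/relabel av addSn ltnS leq_add2l; apply: leq_sum => u _.
by rewrite /relabel; case: ifP.
Qed.

(** The sink stays at height 0 and the others are at most |V| high, so the heights add up to less
    than |V|^2. *)
Lemma progress_stable X EX H : preflow X EX H ->
  progress (#|V| * #|V|)%N EX H -> stable EX H.
Proof.
move=> pf [//|]; rewrite (bigD1 w) //= (pf_sink pf) add0n leqNgt => /negP[].
apply: (@leq_ltn_trans (\sum_(v | v != w) #|V|)).
  by apply: leq_sum => v _; apply: pf_height pf _.
rewrite sum_nat_const ltn_pmul2r; last by apply/card_gt0P; exists w.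
apply: (@proper_card _ (predC1 w) predT).
by apply/properP; split; [exact: subset_predT | exists w; rewrite ?inE ?eqxx].
Qed.

(* Heights drop by at most one along residual arcs, and the [#|V| - 2] inner
   vertices leave one of the levels [1 .. #|V| - 1] empty. *)
Lemma stable_min_cut X EX H : preflow X EX H -> stable EX H ->
  min_cut D r F w (EX w).
Proof.
case=> res0 exE ex0 lab Hr Hw Hn st.
have X0 : nonneg X by move=> e; apply: (res0 (e, true)).
have XF : le_vec X F by move=> e; rewrite -subr_ge0; apply: (res0 (e, false)).
split; last first.
  move=> U /andP[wU rU]; rewrite exE.
  have := sum_net D X U; rewrite (bigD1 w) //= => h.
  have h1 : 0 <= \sum_(v in U | v != w) net D X v.
    apply: sumr_ge0 => v /andP[vU _]; rewrite -exE; apply: ex0.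
    by apply: contraNneq rU => <-.
  have := le_inflow D U XF; have := outflow_ge0 D U X0; lra.
have [k [k0 kn] gap] : exists2 k, (0 < k)%N /\ (k < #|V|)%N &
    forall v, H v != k.
  pose h v : 'I_#|V|.+1 := inord (H v).
  have hE v : h v = H v :> nat by rewrite inordK // ltnS.
  (* The |V| vertices cannot occupy all |V| + 1 heights; the one missed is neither 0 nor |V|, the
     heights of [w] and [r]. *)
  have [/forallP sur|] := boolP [forall k, [exists v, h v == k]].
    pose g k := xchoose (existsP (sur k)).
    have gK : cancel g h by move=> k; apply/eqP; apply: (xchooseP (existsP (sur k))).
    have := leq_card g (can_inj gK); rewrite card_ord; lia.
  rewrite negb_forall => /existsP[k]; rewrite negb_exists => /forallP hk.
  have Hk v : H v != k :> nat by have := hk v; rewrite -val_eqE /= hE.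
  exists k => //; have := Hk r; have := Hk w; have := ltn_ord k.
  rewrite Hr Hw; lia.
pose U := [set v | (H v < k)%N].
exists U; first by rewrite /is_cut !inE Hw Hr k0 -leqNgt ltnW.
have noarc a : src a \notin U -> dst a \in U -> res X a = 0.
  rewrite !inE -leqNgt => h1 h2; apply: le_anti; rewrite res0 andbT leNgt.
  apply/negP => /lab; have := gap (src a); lia.
have := sum_net D X U; rewrite (bigD1 w) /=; last by rewrite inE Hw.
rewrite big1 ?addr0 => [|v /andP[]]; last first.
  rewrite inE => vk vw; apply: le_anti; rewrite -exE st ?ex0 //; last by lia.
  by apply: contraTneq vk => ->; rewrite Hr; lia.
have -> : outflow D X U = 0.
  by apply: big1 => e; rewrite inE => /andP[h1 h2]; apply: (noarc (e, true)).
rewrite subr0 exE => ->; apply: eq_bigr => e; rewrite inE => /andP[h1 h2].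
by have /eqP := noarc (e, false) h2 h1; rewrite /res /= subr_eq0 => /eqP.
Qed.

(** With all edges out of [r] saturated, no residual arc leads from [r] to a lower vertex. *)
Lemma initial_preflow :
  let X e := if tail D e == r then F e else 0 in
  preflow X (net D X) (fun v => if v == r then #|V| else 0%N).
Proof.
move=> X; have X0 : nonneg X by move=> e; rewrite /X; case: ifP.
split=> //; rewrite ?eqxx ?(negPf wr) //.
- case=> e [] /=; first exact: X0.
  by rewrite /res /= /X; case: ifP => _; rewrite ?subrr ?subr0.
- move=> v vr; rewrite /net [X in _ - X]big1 ?subr0 ?sumr_ge0 // => e /eqP tv.
  by rewrite /X tv (negPf vr).
- case=> e [] /=; rewrite /src /dst /res /= /X.
    by case: (tail D e == r) => [_|]; [case: ifP | rewrite ltxx].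
  by case: (tail D e == r); rewrite // subrr ltxx.
- by move=> v; case: ifP.
Qed.

End PushRelabel.

(** * The program *)

Definition ieq a b := TAnd (ILe a b) (ILe b a).

(* Memory.  Integer arrays: 3 sink (also the counter of [for_sinks]), 4 heights,
   5 and 6 edge counters, 7 vertex counter, 8 and 9 round counters, 10 level
   counter [l], which stands for the level [|V| - 1 - l].  Number arrays: 1 f,
   2 preflow, 3 excesses, 4 minimum cuts of c, 5 new value of an edge,
   6 amount of a push or deficit of a sink. *)
Definition copy_prog := SFor 6 1 (SNSet 1 (counter 6) (NGet 0 (counter 6))).

Definition init_prog :=
  SSeq (SFor 7 0 (SSeq (SNSet 3 (counter 7) (NLit 0))
                       (SISet 4 (counter 7) (ILit 0))))
  (SSeq (SISet 4 (IGet 0 (ILit 2)) (IGet 0 (ILit 0)))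
  (SFor 6 1
    (let e := counter 6 in let t := IGet 1 e in let h := IGet 2 e in
     SSeq (SIf (ieq t (IGet 0 (ILit 2)))
               (SNSet 2 e (NGet 1 e)) (SNSet 2 e (NLit 0)))
    (SSeq (SNSet 3 h (NAdd (NGet 3 h) (NGet 2 e)))
          (SNSet 3 t (NSub (NGet 3 t) (NGet 2 e))))))).

Definition push_prog (b : bool) :=
  let e := counter 6 in
  let u := IGet (if b then 2 else 1)%N e in
  let v := IGet (if b then 1 else 2)%N e in
  let d := NGet 6 (ILit 0) in
  SIf (TAnd (ieq (IAdd (IAdd (IGet 4 u) (counter 10)) (ILit 1)) (IGet 0 (ILit 0)))
            (ieq (IGet 4 u) (IAdd (IGet 4 v) (ILit 1))))
    (SSeq (SNSet 6 (ILit 0)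
             (if b then NGet 2 e else NSub (NGet 1 e) (NGet 2 e)))
    (SSeq (SIf (NLe (NGet 3 u) d) (SNSet 6 (ILit 0) (NGet 3 u)) SSkip)
    (SSeq (SNSet 2 e (if b then NSub (NGet 2 e) d else NAdd (NGet 2 e) d))
    (SSeq (SNSet 3 u (NSub (NGet 3 u) d))
          (SNSet 3 v (NAdd (NGet 3 v) d))))))
    SSkip.

Definition relabel_prog :=
  SFor 7 0
    (SIf (TAnd (TNot (ieq (counter 7) (counter 3)))
         (TAnd (ILe (IAdd (IGet 4 (counter 7)) (ILit 1)) (IGet 0 (ILit 0)))
               (TNot (NLe (NGet 3 (counter 7)) (NLit 0)))))
       (SISet 4 (counter 7) (IAdd (IGet 4 (counter 7)) (ILit 1))) SSkip).

Definition pushes_prog :=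
  SFor 10 0 (SFor 6 1 (SSeq (push_prog false) (push_prog true))).

Definition min_cut_prog :=
  SSeq init_prog (SFor 8 0 (SFor 9 0 (SSeq pushes_prog relabel_prog))).

Definition for_sinks p :=
  SFor 3 0 (SIf (ieq (counter 3) (IGet 0 (ILit 2))) SSkip
                (SSeq min_cut_prog p)).

Definition deficit_prog :=
  let w := counter 3 in let b := NGet 5 (ILit 0) in let d := NGet 6 (ILit 0) in
  SSeq (SNSet 6 (ILit 0) (NSub (NGet 4 w) (NGet 3 w)))
       (SIf (NLe d b) SSkip (SNSet 5 (ILit 0) d)).

Definition flame_prog :=
  SSeq copy_prog
  (SSeq (for_sinks (SNSet 4 (counter 3) (NGet 3 (counter 3))))
  (SFor 5 1
    (SSeq (SNSet 1 (counter 5) (NLit 0))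
    (SSeq (SNSet 5 (ILit 0) (NLit 0))
    (SSeq (for_sinks deficit_prog)
          (SNSet 1 (counter 5) (NGet 5 (ILit 0)))))))).

Lemma flame_prog_wf : well_formed flame_prog && linear_prog 4 (compile flame_prog).
Proof. by vm_compute. Qed.

(** * A rule for loops over a finite type *)

Section Frame.
Variable R : realType.
Implicit Types (s : state R).

Definition frame p s s' : Prop :=
  (forall x, x \notin iwrites p -> ints s' x = ints s x) /\
  (forall x, x \notin nwrites p -> nums s' x = nums s x).

Lemma den_frame p s : frame p s (den p s).
Proof. by split=> x xp; rewrite ?den_ints ?den_nums. Qed.

(** The frame between the initial and the current state is handed to the body, so invariants need
    not mention arrays that the loop leaves alone. *)
Lemma for_rule (T : finType) x j p s (Inv : nat -> state R -> Prop) :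
  ints s 0 j = #|T| ->
  (forall i k s', Inv k s' -> Inv k (seti x 0 i s')) ->
  Inv 0%N s ->
  (forall (u : T) s', frame (SFor x j p) s s' -> ints s' x 0 = enum_rank u ->
     Inv (enum_rank u) s' -> Inv (enum_rank u).+1 (den p s')) ->
  Inv #|T| (den (SFor x j p) s).
Proof.
move=> sT Iset I0 IS /=; rewrite sT; apply: (Iset).
suff [] : frame (SFor x j p) s
      (iteri #|T| (fun i s' => den p (seti x 0 i s')) s) /\
    Inv #|T| (iteri #|T| (fun i s' => den p (seti x 0 i s')) s) by [].
have fset i s' : frame (SFor x j p) s s' -> frame (SFor x j p) s (seti x 0 i s').
  case=> f1 f2; split=> y /= yp; last exact: f2.
  rewrite -f1 // /update; move: yp; rewrite inE negb_or => /andP[/negPf -> _].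
  by [].
apply: (iteri_ind (P := fun i s' => frame (SFor x j p) s s' /\ Inv i s')).
  by split=> //; split.
move=> i s' iT [fr Is]; have frs := fset i s' fr.
split.
  have [g1 g2] := den_frame p (seti x 0 i s'); case: frs => f1 f2.
  split=> y yp; last by rewrite g2 // f2.
  by rewrite g1 ?f1 //; move: yp; rewrite /= inE negb_or => /andP[].
have := IS (enum_val (Ordinal iT)) (seti x 0 i s') frs.
by rewrite enum_valK /=; apply; [rewrite /update !eqxx | apply: Iset].
Qed.

End Frame.

(** * Correctness of the program *)

Section Correct.
Variables (R : realType) (V E : finType) (D : digraph V E) (r : V).
Implicit Types (s : state R) (e : E) (u v w : V).

Definition evec x s : E -> R := fun e => nums s x (enum_rank e).
Definition vvec x s : V -> R := fun v => nums s x (enum_rank v).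
Definition height s : V -> nat := fun v => ints s 4 (enum_rank v).

Record static s : Prop := Static {
  st_V : ints s 0 0 = #|V|;
  st_E : ints s 0 1 = #|E|;
  st_r : ints s 0 2 = enum_rank r;
  st_tail : forall e, ints s 1 (enum_rank e) = enum_rank (tail D e);
  st_head : forall e, ints s 2 (enum_rank e) = enum_rank (head D e) }.

Lemma static_frame p s s' : [&& 0%N \notin iwrites p, 1%N \notin iwrites p
    & 2%N \notin iwrites p] -> frame p s s' -> static s -> static s'.
Proof.
case/and3P=> h0 h1 h2 [fr _] [eV eE er et eh].
by split; rewrite ?fr //; move=> e; rewrite fr.
Qed.

Lemma rank_eq (T : finType) (x y : T) :
  ((enum_rank x : nat) == enum_rank y) = (x == y).
Proof. by rewrite val_eqE (inj_eq enum_rank_inj). Qed.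

Lemma teval_ieq s a b : teval s (ieq a b) = (ieval s a == ieval s b).
Proof. by rewrite /= eqn_leq. Qed.

Lemma den_seq p q s : den (SSeq p q) s = den q (den p s).
Proof. by []. Qed.

Lemma copy_prog_correct s : static s -> evec 1 (den copy_prog s) = evec 0 s.
Proof.
move=> st; apply/funext => e.
have := @for_rule R E 6 1 (SNSet 1 (counter 6) (NGet 0 (counter 6))) s
  (fun i s' => forall e, (enum_rank e < i)%N -> evec 1 s' e = evec 0 s e).
rewrite st_E //; apply=> // {}e s' [_ fr] cnt IH e'.
rewrite ltnS leq_eqVlt /evec /= /update /= cnt ?eqxx /=.
rewrite !rank_eq; case: eqP => [-> _|_ /= lt]; first by rewrite fr.
exact: IH.
Qed.

Lemma height_init_correct s : static s ->
  let s' := den (SFor 7 0 (SSeq (SNSet 3 (counter 7) (NLit 0))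
                             (SISet 4 (counter 7) (ILit 0)))) s in
  forall v, vvec 3 s' v = 0 /\ height s' v = 0%N.
Proof.
move=> st s' v.
have := @for_rule R V 7 0 (SSeq (SNSet 3 (counter 7) (NLit 0))
                             (SISet 4 (counter 7) (ILit 0))) s
  (fun i s' => forall v, (enum_rank v < i)%N ->
     vvec 3 s' v = 0 /\ height s' v = 0%N).
rewrite st_V //; apply=> // {}v t _ cnt IH v'.
rewrite ltnS leq_eqVlt /vvec /height /= /update /= cnt !rank_eq rmorph0.
by case: eqP => [-> //|_ /=]; exact: IH.
Qed.

Definition source_flow (F : E -> R) e := if tail D e == r then F e else 0.

Lemma init_prog_correct s : static s -> let s' := den init_prog s in
  [/\ evec 2 s' = source_flow (evec 1 s),
      vvec 3 s' = net D (source_flow (evec 1 s))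
    & height s' = (fun v => if v == r then #|V| else 0%N)].
Proof.
move=> st; rewrite /init_prog !den_seq.
have := height_init_correct st; set p1 := SFor 7 0 _; set s1 := den p1 s.
move=> init1.
have fr1 : frame p1 s s1 := den_frame p1 s.
have st1 : static s1 by apply: static_frame fr1 st.
clearbody s1.
set q := SISet 4 _ _; set s2 := den q s1.
have st2 : static s2.
  by apply: static_frame (den_frame q s1) st1.
have h2 : height s2 = (fun v => if v == r then #|V| else 0%N).
  apply/funext => v; rewrite /height /s2 /= /update /= st_V // st_r //.
  by rewrite rank_eq; case: eqP => // _; exact: (init1 v).2.
have ex2 v : vvec 3 s2 v = 0 by exact: (init1 v).1.
have F2 : evec 1 s2 = evec 1 s.
  by apply/funext => e; rewrite /evec -fr1.2.
clearbody s2 => {q s1 init1 fr1 st1 p1}.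
set p := SSeq (SIf _ _ _) _.
pose X := source_flow (evec 1 s).
(* Array 2 may still hold the preflow of an earlier sink, so edges not yet treated count as 0 in the
   excesses. *)
have := @for_rule R E 6 1 p s2 (fun i s' =>
  [/\ forall e, (enum_rank e < i)%N -> evec 2 s' e = X e,
      vvec 3 s' = net D (fun e => if (enum_rank e < i)%N then X e else 0)
    & height s' = (fun v => if v == r then #|V| else 0%N)]).
rewrite st_E // => /(_ erefl (fun _ _ _ => id)) [||h1 h3 h4].
- split=> //; apply/funext => v; rewrite ex2.
  by rewrite /net !big1 ?subrr.
- move=> e s' fr cnt [IH1 IH2 IH3].
  have st' : static s' by apply: static_frame fr st2.
  have F' : evec 1 s' = evec 1 s by rewrite -F2; apply/funext => e'; rewrite /evec fr.2.
  rewrite /p !den_seq.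
  have -> : den (SIf (ieq (IGet 1 (counter 6)) (IGet 0 (ILit 2)))
      (SNSet 2 (counter 6) (NGet 1 (counter 6)))
      (SNSet 2 (counter 6) (NLit 0))) s' = setn 2 (enum_rank e) (X e) s'.
    rewrite /= cnt st_tail // st_r // -eqn_leq rank_eq /X /source_flow -F'.
    by case: eqP => _ //; rewrite rmorph0.
  set s3 := den _ (den _ _).
  have X3 e' : evec 2 s3 e' = if e' == e then X e else evec 2 s' e'.
    by rewrite /evec /= /update /= rank_eq.
  have ex3 v : vvec 3 s3 v = vvec 3 s' v +
      X e * ((head D e == v)%:R - (tail D e == v)%:R).
    rewrite /vvec /= /update /= cnt st_tail // st_head // !rank_eq !eqxx /=.
    rewrite ![v == _]eq_sym.
    case: (head D e =P v) => [hv|/eqP/negPf hv];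
      case: (tail D e =P v) => [tv|/eqP/negPf tv];
      rewrite ?tv ?hv ?tv ?[v == _]eq_sym ?hv ?eqxx ?mulr1n ?mulr0n /=; lra.
  have h3 : height s3 = height s' by [].
  clearbody s3; split=> [e'||]; last by rewrite h3.
    rewrite X3 ltnS leq_eqVlt rank_eq; case: eqP => [-> //|_ /=].
    exact: IH1.
  apply/funext => v; rewrite ex3 IH2 -net_unit -netD.
  congr (net D _ v); apply/funext => e'.
  rewrite [in RHS]ltnS [in RHS]leq_eqVlt rank_eq.
  case: eqP => [->|_ /=]; last by rewrite addr0.
  by rewrite ltnn add0r.
- split=> //; first by apply/funext => e; apply: h1.
  rewrite h3; apply/funext => v; rewrite /net.
  by congr (_ - _); apply: eq_bigr => e _; rewrite ltn_ord.
Qed.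

Lemma push_prog_correct s e b : static s -> ints s 6 0 = enum_rank e ->
  let d := amount D (evec 1 s) (evec 2 s) (vvec 3 s) (height s)
             (ints s 10 0) (e, b) in
  let s' := den (push_prog b) s in
  [/\ evec 2 s' = push_flow (evec 2 s) (e, b) d,
      vvec 3 s' = push_excess D (vvec 3 s) (e, b) d
    & height s' = height s].
Proof.
move=> st cnt d; rewrite /push_prog; cbv zeta.
set t := TAnd _ _; set p1 := SNSet 6 _ _; set p2 := SIf (NLe _ _) _ _.
set p3 := SNSet 2 _ _; set p4 := SNSet 3 _ _; set p5 := SNSet 3 _ _.
have uE : ints s (if b then 2 else 1)%N (enum_rank e) = enum_rank (src D (e, b)).
  rewrite /src /=; case: b {d t p1 p2 p3 p4 p5};
    by rewrite ?(st_tail st) ?(st_head st).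
have vE : ints s (if b then 1 else 2)%N (enum_rank e) = enum_rank (dst D (e, b)).
  rewrite /dst /=; case: b {d t p1 p2 p3 p4 p5 uE};
    by rewrite ?(st_tail st) ?(st_head st).
have -> : forall p q,
  den (SIf t p q) s = if teval s t then den p s else den q s by [].
have -> : teval s t = admissible D (height s) (ints s 10 0) (e, b).
  rewrite /t -/(_ && _) [teval _ _]/= -!eqn_leq cnt uE vE (st_V st) !addn1.
  by [].
case: ifP => [adm|nadm]; last first.
  by rewrite /d /amount nadm push_flow0 push_excess0.
have uv : src D (e, b) != dst D (e, b).
  by apply/eqP => uv; case/andP: adm => _; rewrite uv; lia.
rewrite !den_seq; set s2 := den p2 _.
have d2 : nums s2 6 0 = d.
  have rE : neval s (if b then NGet 2 (counter 6)
        else NSub (NGet 1 (counter 6)) (NGet 2 (counter 6))) =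
      res (evec 1 s) (evec 2 s) (e, b).
    by rewrite /res /=; case: (b) => /=; rewrite cnt.
  have -> : s2 = if vvec 3 s (src D (e, b)) <= res (evec 1 s) (evec 2 s) (e, b)
      then setn 6 0 (vvec 3 s (src D (e, b))) (den p1 s) else den p1 s.
    by rewrite /s2 /p1 /p2 /= /update /= rE cnt uE.
  rewrite /d /amount adm; by case: ifP => _; rewrite /p1 /= /update /= ?rE.
have i2 : ints s2 = ints s by rewrite /s2 /=; case: ifP.
have n2 x : x != 6%N -> nums s2 x = nums s x.
  by move=> /negPf x6; rewrite /s2 /=; case: ifP => _; rewrite /= /update x6.
clearbody s2; split.
- apply/funext => e'; rewrite /evec /= /update /= i2 cnt rank_eq /push_flow /=.
  by case: eqP => [->|_]; rewrite ?n2 //; case: (b); rewrite /= i2 cnt d2 n2.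
- apply/funext => v; rewrite /vvec /= /update /= i2 cnt uE vE !rank_eq /push_excess /=.
  rewrite d2 n2 // [dst _ _ == _]eq_sym (negPf uv).
  case: (v =P dst D (e, b)) => [->|_]; last first.
    by rewrite addr0; case: eqP => [->|]; rewrite ?subr0.
  by rewrite [dst _ _ == _]eq_sym (negPf uv) subr0.
- by rewrite /height /= i2.
Qed.

Lemma static_den p s : [&& 0%N \notin iwrites p, 1%N \notin iwrites p
    & 2%N \notin iwrites p] -> static s -> static (den p s).
Proof. by move=> wp; apply: static_frame wp (den_frame p s). Qed.

Section MinCut.
Variables (w : V) (F : E -> R).
Hypotheses (wr : w != r) (F0 : nonneg F).

(** Invariant of the pushes in a round that starts with heights [H] and excesses [EX]. *)
Definition pushing (H : V -> nat) (EX : V -> R) s : Prop :=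
  [/\ preflow D r w F (evec 2 s) (vvec 3 s) H, height s = H, evec 1 s = F
    & stable w EX H -> vvec 3 s = EX].

Lemma push_prog_pushing H EX s e b : static s -> ints s 6 0 = enum_rank e ->
  pushing H EX s -> let s' := den (push_prog b) s in pushing H EX s' /\
  forall Q, settled D F H (ints s 10 0) Q (evec 2 s) (vvec 3 s) ->
    settled D F H (ints s 10 0) (fun a => Q a || (a == (e, b)))
      (evec 2 s') (vvec 3 s').
Proof.
move=> st cnt [pf hs fs stab] s'.
have [] := push_prog_correct b st cnt; rewrite -/s' fs hs => X' EX' h'.
rewrite /pushing X' EX'; split=> [|Q]; last exact: push_settled pf.
split=> //; first exact: push_preflow.
  by rewrite /evec /s' den_nums; [exact: fs | case: (b)].
move=> h; have eE := stab h; rewrite -eE in h.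
by rewrite (push_stable wr _ _ pf h) push_excess0.
Qed.

Lemma pushes_prog_pushing H EX s : static s -> pushing H EX s ->
  let s' := den pushes_prog s in pushing H EX s' /\
  settled D F H #|V| xpred0 (evec 2 s') (vvec 3 s').
Proof.
move=> st ps; rewrite /pushes_prog; set body := SFor 6 1 _.
have := @for_rule R V 10 0 body s (fun i s' => pushing H EX s' /\
  settled D F H i xpred0 (evec 2 s') (vvec 3 s')).
apply=> //; first exact: st_V st.
  split=> // a h1 h2 [h3|[]//]; lia.
move=> u s1 fr1 lev [ps1 set1].
have st1 : static s1 by apply: static_frame fr1 st.
have := @for_rule R E 6 1 (SSeq (push_prog false) (push_prog true)) s1
  (fun i s' => pushing H EX s' /\
    settled D F H (enum_rank u) (fun a => (enum_rank a.1 < i)%N)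
      (evec 2 s') (vvec 3 s')).
rewrite (st_E st1) -/body => /(_ erefl (fun _ _ _ => id)) [].
- by split.
- move=> e s2 fr2 cnt [ps2 set2]; rewrite den_seq.
  have st2 : static s2 by apply: static_frame fr2 st1.
  have lev2 : ints s2 10 0 = enum_rank u by rewrite fr2.1.
  have [ps3 set3] := push_prog_pushing false st2 cnt ps2.
  set s3 := den (push_prog false) s2 in ps3 set3 *.
  have st3 : static s3 by apply: static_den st2.
  have cnt3 : ints s3 6 0 = enum_rank e by rewrite den_ints.
  have lev3 : ints s3 10 0 = enum_rank u by rewrite den_ints.
  have [ps4 set4] := push_prog_pushing true st3 cnt3 ps3.
  split=> //; rewrite lev3 in set4; rewrite lev2 in set3.
  move=> a h1 h2 h3; apply: (set4 _ (set3 _ set2)) => //.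
  case: h3 => [|[h3 h4]]; [by left | right; split=> //].
  move: h4; rewrite ltnS leq_eqVlt rank_eq => /orP[/eqP h4|->] //.
  by rewrite (surjective_pairing a) h4; case: a.2; rewrite eqxx ?orbT.
move=> ps2 set2; split=> // a h1 h2 [h3|[]//]; apply: set2 => //.
(* With all edges treated, passing from [l] to [l + 1] adds exactly the level just finished. *)
have [h4|h4] := leqP #|V| (height s1 (src D a) + enum_rank u).
  by left; case: ps1 => _ <-.
right; split; last exact: ltn_ord.
by move: h3 h4; case: ps1 => _ -> _ _; lia.
Qed.

(** The test for a vertex reads no height but its own, so raising in place agrees with the
    simultaneous [relabel]. *)
Lemma relabel_prog_correct s : static s -> ints s 3 0 = enum_rank w ->
  height (den relabel_prog s) = relabel w (vvec 3 s) (height s).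
Proof.
move=> st sink; rewrite /relabel_prog; set body := SIf _ _ _.
pose Inv i s' := forall v, height s' v =
  if (enum_rank v < i)%N then relabel w (vvec 3 s) (height s) v else height s v.
suff h : Inv #|V| (den (SFor 7 0 body) s).
  by apply/funext => v; rewrite h ltn_ord.
apply: for_rule => //; first exact: st_V st.
  move=> u s1 fr cnt IH v.
  have st1 : static s1 by apply: static_frame fr st.
  have sink1 : ints s1 3 0 = enum_rank w by rewrite fr.1.
  have Hu : ints s1 4 (enum_rank u) = height s u.
    by have := IH u; rewrite ltnn.
  rewrite /body /= cnt sink1 (st_V st1) rmorph0 -eqn_leq rank_eq fr.2 // Hu addn1.
  rewrite [in RHS]ltnS [in RHS]leq_eqVlt rank_eq {1}/relabel {1}/active -/(vvec 3 s u).
  have := IH v.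
  have [-> _|ne] := eqVneq v u.
    rewrite /relabel /active /=; case: ifP => _; rewrite /height /= /update /=.
      by rewrite ?cnt eqxx ?Hu.
    by rewrite ?Hu.
  move=> <-; case: ifP => _ //; rewrite /height /= /update /=.
  by rewrite ?cnt rank_eq (negPf ne).
Qed.

Lemma min_cut_prog_correct s : static s -> ints s 3 0 = enum_rank w ->
  evec 1 s = F -> min_cut D r F w (vvec 3 (den min_cut_prog s) w).
Proof.
move=> st sink Fs; rewrite /min_cut_prog den_seq.
have [X1 EX1 H1] := init_prog_correct st.
have st1 : static (den init_prog s) by apply: static_den st.
have sink1 : ints (den init_prog s) 3 0 = enum_rank w by rewrite den_ints.
have F1 : evec 1 (den init_prog s) = F by rewrite /evec den_nums.
move: (den init_prog s) X1 EX1 H1 st1 sink1 F1 => s1; rewrite Fs => X1 EX1 H1.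
move=> st1 sink1 F1.
pose good k s' := [/\ evec 1 s' = F,
  preflow D r w F (evec 2 s') (vvec 3 s') (height s')
  & progress w k (vvec 3 s') (height s')].
suff : good (#|V| * #|V|)%N
    (den (SFor 8 0 (SFor 9 0 (SSeq pushes_prog relabel_prog))) s1).
  case=> _ pf pr; have stab := progress_stable pf pr.
  exact: (stable_min_cut wr pf stab).
have := @for_rule R V 8 0 (SFor 9 0 (SSeq pushes_prog relabel_prog)) s1
  (fun i => good (i * #|V|)%N); apply=> //; first exact: st_V st1.
  split=> //; last by right.
  by rewrite X1 EX1 H1; apply: initial_preflow.
move=> u s2 fr2 _ good2.
have st2 : static s2 by apply: static_frame fr2 st1.
have sink2 : ints s2 3 0 = enum_rank w by rewrite fr2.1.
rewrite mulSn addnC.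
have := @for_rule R V 9 0 (SSeq pushes_prog relabel_prog) s2
  (fun i => good (enum_rank u * #|V| + i)%N); apply=> //; first exact: st_V st2.
  by rewrite addn0.
move=> u' s3 fr3 _ [F3 pf3 pr3]; rewrite den_seq addnS.
have st3 : static s3 by apply: static_frame fr3 st2.
have sink3 : ints s3 3 0 = enum_rank w by rewrite fr3.1.
have [] := @pushes_prog_pushing (height s3) (vvec 3 s3) s3 st3 _; first by split.
have st4 : static (den pushes_prog s3) by apply: static_den st3.
have sink4 : ints (den pushes_prog s3) 3 0 = enum_rank w by rewrite den_ints.
move: (den pushes_prog s3) st4 sink4 => s4 st4 sink4 [pf4 H4 F4 E4] set4.
have H5 := relabel_prog_correct st4 sink4.
have n5 x : nums (den relabel_prog s4) x = nums s4 x by rewrite den_nums.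
rewrite /good H5 /evec /vvec !n5 -/(evec 1 s4) -/(evec 2 s4) -/(vvec 3 s4).
rewrite H4; split=> //; first exact: (relabel_preflow wr pf4 set4).
apply: relabel_progress.
(* The pushes keep the excesses if the state was stable, and they always keep the heights. *)
by case: pr3 => [stab|]; [left; rewrite E4 | right].
Qed.

End MinCut.

(** As [p] does not write number array 1, every call of [min_cut_prog] works on the same [F]. *)
Lemma for_sinks_rule p s F (Inv : nat -> state R -> Prop) :
  static s -> evec 1 s = F -> nonneg F ->
  [&& 0%N \notin iwrites p, 1%N \notin iwrites p, 2%N \notin iwrites p
    & 1%N \notin nwrites p] ->
  (forall i k s', Inv k s' -> Inv k (seti 3 0 i s')) -> Inv 0%N s ->
  (forall s', Inv (enum_rank r) s' -> Inv (enum_rank r).+1 s') ->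
  (forall w s' s'', w != r -> frame (for_sinks p) s s' ->
     Inv (enum_rank w) s' -> frame min_cut_prog s' s'' ->
     ints s'' 3 0 = enum_rank w -> min_cut D r F w (vvec 3 s'' w) ->
     Inv (enum_rank w).+1 (den p s'')) ->
  Inv #|V| (den (for_sinks p) s).
Proof.
move=> st Fs F0 /and4P[p0 p1 p2 pn] Iset I0 Ir IS.
apply: for_rule => //; first exact: st_V st.
move=> w s' fr cnt Is.
have st' : static s'.
  by apply: static_frame fr st; rewrite /= !inE p0 p1 p2.
have Fs' : evec 1 s' = F by rewrite -Fs /evec fr.2.
have -> : forall t q,
  den (SIf t SSkip q) s' = if teval s' t then s' else den q s' by [].
rewrite teval_ieq [ieval _ _]/= cnt [ieval _ _]/= (st_r st') rank_eq.
have [wr|wr] := eqVneq w r; first by rewrite wr; apply: Ir; rewrite -wr.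
rewrite den_seq; apply: (IS w s') => //.
- exact: den_frame.
- by rewrite den_ints.
- exact: min_cut_prog_correct.
Qed.

Lemma source_cuts_correct s F : static s -> evec 1 s = F -> nonneg F ->
  let p := SNSet 4 (counter 3) (NGet 3 (counter 3)) in
  forall w, w != r -> min_cut D r F w (vvec 4 (den (for_sinks p) s) w).
Proof.
move=> st Fs F0 p w wr.
suff h : forall w, w != r -> (enum_rank w < #|V|)%N ->
    min_cut D r F w (vvec 4 (den (for_sinks p) s) w).
  by apply: h => //; apply: ltn_ord.
apply: (for_sinks_rule (Inv := fun i s' => forall w, w != r ->
  (enum_rank w < i)%N -> min_cut D r F w (vvec 4 s' w))) st Fs F0 _ _ _ _ _ => //.
  move=> s' IH v vr; rewrite ltnS leq_eqVlt rank_eq (negPf vr); exact: IH.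
move=> {}w s' s'' {}wr fr IH fr' cnt cutw v vr.
rewrite ltnS leq_eqVlt rank_eq /vvec /= /update /= cnt rank_eq.
by case: eqP => [-> _ //|_ /=]; rewrite fr'.2 //; apply: IH.
Qed.

Lemma deficit_correct s F (M : V -> R) : static s -> evec 1 s = F ->
  nonneg F -> (forall w, w != r -> min_cut D r F w (M w)) -> nums s 5 0 = 0 ->
  let b := nums (den (for_sinks deficit_prog) s) 5 0 in
  let L := vvec 4 s in
  [/\ 0 <= b, forall w, w != r -> L w - M w <= b
    & b = 0 \/ exists2 w, w != r & b = L w - M w].
Proof.
move=> st Fs F0 FM b0 b L.
suff [h1 h2 h3] : [/\ 0 <= b,
    forall w, w != r -> (enum_rank w < #|V|)%N -> L w - M w <= b
    & b = 0 \/ exists2 w, w != r & b = L w - M w].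
  by split=> // w wr; apply: h2 => //; apply: ltn_ord.
apply: (for_sinks_rule (Inv := fun i s' => [/\ 0 <= nums s' 5 0,
    forall w, w != r -> (enum_rank w < i)%N -> L w - M w <= nums s' 5 0
    & nums s' 5 0 = 0 \/ exists2 w, w != r & nums s' 5 0 = L w - M w]))
    st Fs F0 _ _ _ _ _ => //.
- by rewrite b0; split=> //; left.
- move=> s' [h1 h2 h3]; split=> // v vr.
  by rewrite ltnS leq_eqVlt rank_eq (negPf vr); apply: h2.
move=> w s' s'' wr fr [h1 h2 h3] fr' cnt cutw.
have L'' : nums s'' 4 (enum_rank w) = L w by rewrite fr'.2 ?fr.2.
(* The minimum cut just computed equals the given [M w] by uniqueness. *)
have M'' : nums s'' 3 (enum_rank w) = M w := min_cut_unique cutw (FM w wr).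
have b'' : nums s'' 5 0 = nums s' 5 0 by rewrite fr'.2.
set d := L w - M w.
have -> : nums (den deficit_prog s'') 5 0 = if d <= nums s' 5 0 then nums s' 5 0 else d.
  rewrite /= cnt L'' M'' /update /= b'' -/d.
  by case: ifP.
split.
- by case: ifP => // /negbT; rewrite -ltNge => /ltW; apply: le_trans.
- move=> v vr; rewrite ltnS leq_eqVlt rank_eq => /orP[/eqP ->|lt].
    by rewrite -/d; case: ifP.
  case: ifP => [_|/negbT]; first exact: h2.
  by rewrite -ltNge => /ltW; apply: le_trans; apply: h2.
- by case: ifP => _ //; right; exists w.
Qed.

Lemma static_input c : static (input D r c).
Proof.
split=> //= e.
  by rewrite (nth_map e) ?nth_enum_rank // -cardE.
by rewrite (nth_map e) ?nth_enum_rank // -cardE.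
Qed.

Lemma evec_input c : evec 0 (input D r c) = c.
Proof.
by apply/funext => e; rewrite /evec /= (nth_map e) ?nth_enum_rank // -cardE.
Qed.

Lemma flame_prog_correct c : nonneg c ->
  preserves_connectivity D r c (evec 1 (den flame_prog (input D r c))).
Proof.
move=> c0; rewrite /flame_prog; cbv zeta; rewrite !den_seq.
have st0 := static_input c; have := copy_prog_correct st0; rewrite evec_input.
have st1 : static (den copy_prog (input D r c)) by apply: static_den.
move: (den copy_prog _) st1 => s1 st1 F1.
have := source_cuts_correct st1 F1 c0; cbv zeta.
set q := SNSet 4 _ _.
have F2 : evec 1 (den (for_sinks q) s1) = c by rewrite /evec den_nums.
have st2 : static (den (for_sinks q) s1) by apply: static_den.
move: (den (for_sinks q) s1) F2 st2 => s2 F2 st2 cL {q s1 F1 st1 st0}.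
set L := vvec 4 s2 in cL; set body := SSeq (SNSet 1 _ _) _.
apply: (reduced_preserves c0 cL).
pose Inv i s := reduced D r c L (fun e => (enum_rank e < i)%N) (evec 1 s).
suff [f0 fc fL tight] : Inv #|E| (den (SFor 5 1 body) s2).
  by split=> // e _; apply: tight; apply: ltn_ord.
apply: for_rule => //; first exact: st_E st2.
  by rewrite /Inv F2; split.
move=> e s3 fr cnt; rewrite /Inv => red.
have st3 : static s3 by apply: static_frame fr st2.
have L3 : vvec 4 s3 = L by rewrite /vvec fr.2.
rewrite /body !den_seq.
set f := evec 1 s3 in red *.
set s4 := den (SNSet 5 _ _) _.
have st4 : static s4 by do 2 apply: static_den => //.
have F4 : evec 1 s4 = set_edge f e 0.
  apply/funext => e'; rewrite /evec /= /update /= cnt rank_eq rmorph0.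
  by [].
have b4 : nums s4 5 0 = 0 by rewrite /= /update /= rmorph0.
have L4 : vvec 4 s4 = L by rewrite -L3.
have cnt4 : ints s4 5 0 = enum_rank e by [].
clearbody s4.
have f0 : nonneg (set_edge f e 0).
  by case: red => h _ _ _ e'; rewrite /set_edge; case: eqP.
(* Flow connectivity supplies the minimum cuts with [e] removed, for comparison with the computed
   ones. *)
pose M w := flow_connectivity D r (set_edge f e 0) w.
have FM w : w != r -> min_cut D r (set_edge f e 0) w (M w).
  exact: flow_connectivity_min_cut.
have [] := deficit_correct st4 F4 f0 FM b4; rewrite L4.
set s5 := den (for_sinks _) s4 => h1 h2 h3.
have F5 : evec 1 s5 = set_edge f e 0 by rewrite /evec den_nums.
have cnt5 : ints s5 5 0 = enum_rank e by rewrite den_ints.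
clearbody s5.
have -> : evec 1 (den (SNSet 1 (counter 5) (NGet 5 (ILit 0))) s5) =
    set_edge f e (nums s5 5 0).
  apply/funext => e'; rewrite /evec /= /update /= cnt5 rank_eq /set_edge.
  case: eqP => // ne; move/(congr1 (fun g => g e')): F5.
  by rewrite /set_edge; case: eqP.
have [g0 gc gL tight] := reduced_step red FM h1 h2 h3.
split=> // e'; rewrite ltnS leq_eqVlt rank_eq => /orP[/eqP h|h]; apply: tight.
  by right.
by left.
Qed.

End Correct.

Theorem theorem4 (R : realType) :
  (forall (V E : finType) (D : digraph V E) (r : V) (c : E -> R), nonneg c ->
     (exists f : E -> R, preserves_connectivity D r c f) /\
     (integral_vec c ->
        exists f : E -> R, preserves_connectivity D r c f /\ integral_vec f)) /\
  (exists p : prog,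
     strongly_polynomial_algorithm
       (fun (V E : finType) (D : digraph V E) (r : V) (c f : E -> R) =>
          preserves_connectivity D r c f /\ (integral_vec c -> integral_vec f))
       p).
Proof.
have [wf lin] := andP flame_prog_wf.
have correct (V E : finType) (D : digraph V E) (r : V) (c : E -> R) : nonneg c ->
    preserves_connectivity D r c (evec 1 (den flame_prog (input D r c))) /\
    (integral_vec c ->
       integral_vec (@evec R E 1 (den flame_prog (input D r c)))).
  move=> c0; split; first exact: flame_prog_correct.
  by move=> ci e; apply: (den_integral D r _ wf lin ci).
split; last first.
  by exists (compile flame_prog); apply: linear_strongly_polynomial.
move=> V E D r c c0; have [pres int] := correct V E D r c c0.
split=> [|ci]; exists (evec 1 (den flame_prog (input D r c))) => //.
by split=> //; apply: int.
Qed.
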